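(* Let $n>1$ and let DLF be any deadlock-free mutual exclusion protocol for $n$ processes. Then Algorithm B (given in the context), run by $p_0,\dots,p_{n-1}$ on top of DLF, with safe registers FLAG$[0],\dots,$FLAG$[n-1]$ and TURN, satisfies an intermittent bounded bypass of $n^2-2$ within $n$ interrupting assignments.
   Context: Setting. $n$ processes $p_0,\dots,p_{n-1}$ run in parallel, each sequentially executing its code. Processes are reliable (each correctly executes its code and keeps making progress) and asynchronous (arbitrary finite speed). They interact through shared registers by reads and writes, which take time, are non-blocking, may overlap, and always terminate. Each process may repeatedly invoke $\mathtt{lock}$; when its $\mathtt{lock}$ terminates it enters its critical section, which it leaves after finite time, then running $\mathtt{unlock}$. A mutual exclusion protocol guarantees that at most one process at a time is in its critical section. It is deadlock-free if, whenever at some time at least one process is running its $\mathtt{lock}$, then afterwards some process will enter its critical section. Safe registers: initially, and whenever a write terminates while no other write on the register is going on, the register contains a well-defined value that does not change until a next write commences; when a write of $v$ overlapping no other write terminates, $v$ becomes its value; a read overlapping no write returns its value; a read overlapping a write may return any value of the register's domain, and after overlapping writes the register may hold any value of its domain. Algorithm B. DLF, with functions DLF.lock and DLF.unlock, is used as a black box operating on its own registers (on which it is a correct deadlock-free mutual exclusion protocol); the code executed by a process between the end of DLF.lock and the start of DLF.unlock plays the role of DLF's critical section. Shared registers: FLAG$[i]\in\{0,1\}$ for each $i$, and TURN $\in\{0,\dots,n-1\}$; $tmp$ is local. Line 1: initialize FLAG$[i]$ to 0 for all $i$, and TURN to any process ID. Line 3: $\mathtt{lock}(i)$ := Line 4: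 FLAG$[i]\leftarrow 1$ (write W1) Line 5: repeat Line 6: $tmp\leftarrow$ TURN (read R1) Line 7: until ($tmp=i$ or FLAG$[tmp]=0$) (read R2) Line 8: DLF.lock$(i)$ Line 10: $\mathtt{unlock}(i)$ := Line 11: FLAG$[i]\leftarrow 0$ (write W2) Line 12: $tmp\leftarrow$ TURN (read R3) Line 13: if FLAG$[tmp]=0$ (read R4) then Line 14: TURN $\leftarrow (tmp+1)\bmod n$ (write W3) Line 15: DLF.unlock$(i)$ A process $p_i$ running $\mathtt{lock}$ loses a competition with $p_j$, $j\ne i$, each time a $\mathtt{lock}$ of $p_j$ overlapping in time with that $\mathtt{lock}$ of $p_i$ terminates earlier than it; the loss occurs at the moment $p_j$'s $\mathtt{lock}$ terminates. Intermittent bounded bypass. A function (in particular $\mathtt{lock}$) is said to start when its first instruction starts. A protocol satisfies an intermittent bounded bypass of $f(n)$ within $h(n)$ interrupting assignments if a set $S$ of assignments (writes) to shared registers can be defined such that each time a process $p_i$ starts its $\mathtt{lock}$, it will reach its critical section after a period $\pi$ such that (i) at most $h(n)$ assignments in $S$ are made within $\pi$, and (ii) $p_i$ enters its critical section losing at most $f(n)$ competitions with the other processes in those parts of $\pi$ that are outside the execution of assignments in $S$. Assignments in $S$ may be made by any process; membership in $S$ may depend on the process $p_i$ considered and on the run; assignments in $S$ that start before $\pi$ or end after it but overlap with $\pi$ are counted among those made within $\pi$.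
   Formalization: The set S may depend on the particular execution of lock (the period π), not only on p_i and the run; with one S for all locks of p_i in a run the claim fails for n ≥ 3, since a W1 needed in one period can overlap the next and give n+1 interrupting assignments. *)

(* Defs.v *)
From mathcomp Require Import all_boot.

Set Implicit Arguments.
Unset Strict Implicit.
Unset Printing Implicit Defensive.

(* Reads and writes take time: each has a start event and an end event.       *)
(* [R] is the type of registers and [V r] is the domain of register [r].      *)
Inductive mem_event (R : Type) (V : R -> Type) : Type :=
| RStart (r : R)
| REnd (r : R) (v : V r)
| WStart (r : R) (v : V r)
| WEnd (r : R).
Arguments RStart {R V} r.
Arguments REnd {R V} r v.
Arguments WStart {R V} r v.
Arguments WEnd {R V} r.

(* Time is discrete, with at most one event at each time. [None] means that   *)
(* no memory event takes place at that time.                                  *)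
Definition mem_history (n : nat) (R : Type) (V : R -> Type) : Type :=
  nat -> option ('I_n * mem_event V).

Section SafeRegister.
Variables (n : nat) (R : Type) (V : R -> Type).
Implicit Types (h : mem_history n V) (p : 'I_n) (r : R) (s e t : nat).

(* [p] has no memory event strictly between [s] and [e]. *)
Definition silent h p s e : Prop :=
  forall t m, s < t < e -> h t <> Some (p, m).

Definition is_read h p r (v : V r) s e : Prop :=
  [/\ s < e, h s = Some (p, RStart r), h e = Some (p, REnd r v)
    & silent h p s e].

Definition is_write h p r (v : V r) s e : Prop :=
  [/\ s < e, h s = Some (p, WStart r v), h e = Some (p, WEnd r)
    & silent h p s e].

Definition overlap (I J : nat * nat) : Prop := (I.1 <= J.2) && (J.1 <= I.2).

(* [content t] is the value held by [r] just before the event at time [t]; it *)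
(* is meaningful only if no write on [r] is then going on. It is left         *)
(* unconstrained right after a write that overlaps another write, and so is   *)
(* the value returned by a read that overlaps a write.                        *)
Definition safe_register h r (v0 : V r) : Prop :=
  exists content : nat -> V r,
  [/\ content 0 = v0,
      forall t,
        (forall p (v : V r) s e, is_write h p v s e -> ~ (s <= t <= e)) ->
        content t.+1 = content t,
      forall p (v : V r) s e, is_write h p v s e ->
        (forall p' (v' : V r) s' e', is_write h p' v' s' e' -> s' <> s ->
           ~ overlap (s, e) (s', e')) ->
        content e.+1 = v
    & forall p (v : V r) s e, is_read h p v s e ->
        (forall p' (v' : V r) s' e', is_write h p' v' s' e' ->
           ~ overlap (s, e) (s', e')) ->
        v = content s].

End SafeRegister.

Inductive instr (R : Type) (V : R -> Type) (L : Type) : Type :=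
| Read (r : R) (k : V r -> L)
| Write (r : R) (v : V r) (l : L)
| Local (l : L)
| Return.
Arguments Read {R V L} r k.
Arguments Write {R V L} r v l.
Arguments Local {R V L} l.
Arguments Return {R V L}.

(* A protocol consists, for each process, of the code of its functions [lock] *)
(* and [unlock], given as a state machine over local states (program counter  *)
(* and local variables). [lock_entry i l] is the local state at the first     *)
(* instruction of [lock] invoked from local state [l]. [mem_ok] tells which   *)
(* histories the shared registers of the protocol allow; their kind (safe,    *)
(* regular, atomic...) and their initial values are part of it.               *)
Record protocol (n : nat) : Type := Protocol {
  reg : Type;
  dom : reg -> Type;
  mem_ok : mem_history n dom -> Prop;
  lstate : Type;
  linit : 'I_n -> lstate;
  lock_entry : 'I_n -> lstate -> lstate;
  unlock_entry : 'I_n -> lstate -> lstate;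
  code : 'I_n -> lstate -> instr dom lstate }.

Inductive phase : Type := Remainder | Locking | Critical | Unlocking.

Section Protocol.
Variables (n : nat) (P : protocol n).

Inductive event : Type :=
| Mem (m : mem_event (@dom n P))
| Step
| Ret.

(* [busy] holds while a read or a write of the process is going on. *)
Record pconf : Type := PConf { ph : phase; loc : lstate P; busy : bool }.

(* The first event of a [lock] or an [unlock] is that of its first            *)
(* instruction: there is no separate invocation event.                        *)
Inductive pstep (i : 'I_n) : pconf -> event -> pconf -> Prop :=
| step_rstart f l r k : f = Locking \/ f = Unlocking ->
    code i l = Read r k ->
    pstep i (PConf f l false) (Mem (RStart r)) (PConf f l true)
| step_rend f l r k v : code i l = Read r k ->
    pstep i (PConf f l true) (Mem (REnd r v)) (PConf f (k v) false)
| step_wstart f l r v l' : f = Locking \/ f = Unlocking ->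
    code i l = Write r v l' ->
    pstep i (PConf f l false) (Mem (WStart r v)) (PConf f l true)
| step_wend f l r v l' : code i l = Write r v l' ->
    pstep i (PConf f l true) (Mem (WEnd r)) (PConf f l' false)
| step_local f l l' : f = Locking \/ f = Unlocking ->
    code i l = Local l' ->
    pstep i (PConf f l false) Step (PConf f l' false)
| step_ret_lock l : code i l = Return ->
    pstep i (PConf Locking l false) Ret (PConf Critical l false)
| step_ret_unlock l : code i l = Return ->
    pstep i (PConf Unlocking l false) Ret (PConf Remainder l false)
| step_lock l a c : pstep i (PConf Locking (lock_entry i l) false) a c ->
    pstep i (PConf Remainder l false) a c
| step_unlock l a c : pstep i (PConf Unlocking (unlock_entry i l) false) a c ->
    pstep i (PConf Critical l false) a c.

Definition trace : Type := nat -> option ('I_n * event).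

(* [cf t i] is the configuration of process [i] just before time [t]. *)
Definition confs : Type := nat -> 'I_n -> pconf.

Definition history (tr : trace) : mem_history n (@dom n P) :=
  fun t => if tr t is Some (p, Mem m) then Some (p, m) else None.

(* The last clause says that processes are reliable, that reads and writes    *)
(* terminate, and that a process leaves its critical section after finite     *)
(* time; a process may stay in its remainder section forever.                 *)
Definition run (tr : trace) (cf : confs) : Prop :=
  [/\ forall i, cf 0 i = PConf Remainder (linit P i) false,
      forall t, match tr t with
                | Some (i, a) => pstep i (cf t i) a (cf t.+1 i) /\
                                 forall j, j <> i -> cf t.+1 j = cf t j
                | None => forall j, cf t.+1 j = cf t j
                end,
      mem_ok (history tr)
    & forall i t, ph (cf t i) <> Remainder ->
        exists2 t', t <= t' & exists a, tr t' = Some (i, a)].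

Definition lock_starts (cf : confs) (i : 'I_n) (t : nat) : Prop :=
  ph (cf t i) = Remainder /\ ph (cf t.+1 i) <> Remainder.

(* Termination of [lock] is also the entry into the critical section. *)
Definition lock_ends (cf : confs) (i : 'I_n) (t : nat) : Prop :=
  ph (cf t i) <> Critical /\ ph (cf t.+1 i) = Critical.

Definition lock_exec (cf : confs) (i : 'I_n) (a b : nat) : Prop :=
  [/\ a <= b, lock_starts cf i a, lock_ends cf i b
    & forall t, a <= t < b -> ~ lock_ends cf i t].

Definition mutual_exclusion : Prop :=
  forall tr cf, run tr cf -> forall t i j,
    ph (cf t i) = Critical -> ph (cf t j) = Critical -> i = j.

Definition deadlock_free : Prop :=
  forall tr cf, run tr cf -> forall t i, ph (cf t i) = Locking ->
    exists2 t', t <= t' & exists j, lock_ends cf j t'.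

(* During its lock of time interval [(a, b)], process [i] loses a competition *)
(* with process [x.1] at time [x.2].                                          *)
Definition loses (cf : confs) (i : 'I_n) (a b : nat) (x : 'I_n * nat) : Prop :=
  exists a', [/\ x.1 <> i, lock_exec cf x.1 a' x.2,
                 overlap (a', x.2) (a, b) & x.2 < b].

(* An execution of an assignment is identified with its time interval: its    *)
(* start time determines the process, the register and the value.             *)
Definition assignment (tr : trace) (w : nat * nat) : Prop :=
  exists p r (v : dom r), is_write (history tr) p v w.1 w.2.

Definition at_most (T : eqType) (m : nat) (Q : T -> Prop) : Prop :=
  exists2 s : seq T, size s <= m & forall x, Q x -> x \in s.

(* The set [S] is relative to the run, to the process [i] and to the          *)
(* execution of its [lock] (started at [a]) whose period is considered.       *)
Definition intermittent_bounded_bypass (f h : nat -> nat) : Prop :=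
  forall tr cf, run tr cf -> forall i a, lock_starts cf i a ->
  exists (S : nat * nat -> Prop) (b : nat),
  [/\ forall w, S w -> assignment tr w,
      lock_exec cf i a b,
      at_most (h n) (fun w => S w /\ overlap w (a, b))
    & at_most (f n) (fun x => loses cf i a b x /\
                              forall w, S w -> ~ (w.1 <= x.2 <= w.2))].

End Protocol.

Section AlgorithmB.
Variables (n : nat) (D : protocol n) (turn0 : 'I_n).

Inductive regB : Type := FLAG (i : 'I_n) | TURN | Own (r : reg D).

Definition domB (r : regB) : Type :=
  match r with FLAG _ => bool | TURN => 'I_n | Own r => dom r end.

Definition own_event (m : mem_event domB) : option (mem_event (@dom n D)) :=
  match m with
  | RStart (Own r) => Some (RStart r)
  | REnd r v =>
      match r return domB r -> option (mem_event (@dom n D)) with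
      | Own r' => fun v => Some (REnd r' v)
      | _ => fun _ => None
      end v
  | WStart r v =>
      match r return domB r -> option (mem_event (@dom n D)) with
      | Own r' => fun v => Some (WStart r' v)
      | _ => fun _ => None
      end v
  | WEnd (Own r) => Some (WEnd r)
  | _ => None
  end.

Definition own_history (h : mem_history n domB) : mem_history n (@dom n D) :=
  fun t => if h t is Some (p, m) then omap (pair p) (own_event m) else None.

Definition mem_okB (h : mem_history n domB) : Prop :=
  [/\ forall i, @safe_register n regB domB h (FLAG i) false,
      @safe_register n regB domB h TURN turn0
    & mem_ok (own_history h)].

Inductive lineB : Type :=
| SetFlag                   (* FLAG[i] <- 1                         (W1) *)
| ReadTurn                  (* tmp <- TURN                          (R1) *)
| TestFlag (tmp : 'I_n)     (* until tmp = i or FLAG[tmp] = 0       (R2) *)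
| DLFLock                   (* DLF.lock(i)                               *)
| ResetFlag                 (* FLAG[i] <- 0                         (W2) *)
| ReadTurn'                 (* tmp <- TURN                          (R3) *)
| TestFlag' (tmp : 'I_n)    (* if FLAG[tmp] = 0 then                (R4) *)
| SetTurn (tmp : 'I_n)      (*   TURN <- (tmp + 1) mod n            (W3) *)
| DLFUnlock.                (* DLF.unlock(i)                             *)

(* The second component is the local state of DLF. *)
Definition lstateB : Type := (lineB * lstate D)%type.

Definition dlf_instr (c : lineB) (x : instr (@dom n D) (lstate D)) :
    instr domB lstateB :=
  match x with
  | Read r k => @Read regB domB lstateB (Own r) (fun v => (c, k v))
  | Write r v l => @Write regB domB lstateB (Own r) v (c, l)
  | Local l => Local (c, l)
  | Return => Return
  end.

Definition codeB (i : 'I_n) (s : lstateB) : instr domB lstateB :=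
  let l := s.2 in
  let dlf_lock := (DLFLock, lock_entry i l) in
  let dlf_unlock := (DLFUnlock, unlock_entry i l) in
  match s.1 with
  | SetFlag => @Write regB domB lstateB (FLAG i) true (ReadTurn, l)
  | ReadTurn => @Read regB domB lstateB TURN (fun tmp => (TestFlag tmp, l))
  | TestFlag tmp =>
      if tmp == i then Local dlf_lock
      else @Read regB domB lstateB (FLAG tmp)
             (fun flag : bool => if flag then (ReadTurn, l) else dlf_lock)
  | DLFLock => dlf_instr DLFLock (code i l)
  | ResetFlag => @Write regB domB lstateB (FLAG i) false (ReadTurn', l)
  | ReadTurn' => @Read regB domB lstateB TURN (fun tmp => (TestFlag' tmp, l))
  | TestFlag' tmp =>
      @Read regB domB lstateB (FLAG tmp)
        (fun flag : bool => if flag then dlf_unlock else (SetTurn tmp, l))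
  | SetTurn tmp => @Write regB domB lstateB TURN (ordS tmp) dlf_unlock
  | DLFUnlock => dlf_instr DLFUnlock (code i l)
  end.

(* The line in the initial local state is irrelevant. *)
Definition algorithmB : protocol n :=
  {| reg := regB;
     dom := domB;
     mem_ok := mem_okB;
     lstate := lstateB;
     linit := fun i => (SetFlag, linit D i);
     lock_entry := fun _ s => (SetFlag, s.2);
     unlock_entry := fun _ s => (ResetFlag, s.2);
     code := codeB |}.

End AlgorithmB.

(* Main.v *)
Require Import Defs.
From mathcomp Require Import all_boot zify.
From Stdlib Require Import Classical ClassicalEpsilon FunctionalExtensionality.

(* A run of Algorithm B projects to a run of DLF in which a process is         *)
(* critical from the end of DLF.lock to the first step of DLF.unlock. Hence    *)
(* R3, R4 and W3 are executed in mutual exclusion, writes of TURN never        *)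
(* overlap, and each of them increments TURN.                                  *)
(* Let W1 of p_i end at e0. From the first entry after e0 on, any process that *)
(* tests FLAG[i] in R4 finds it up, so TURN never leaves i; before that it     *)
(* takes each value k <> i during a single visit. In the visit of k, once      *)
(* FLAG[k] is up it stays up, and a process that entered its critical section  *)
(* in the visit can no longer leave the loop of line 5: each of the n - 1      *)
(* processes other than p_i enters at most once. While FLAG[k] is down, an     *)
(* entry makes TURN leave k: there is at most one. The remaining entries       *)
(* occur during a write W1 of p_k, which is unique in the visit. So S consists *)
(* of that write for each k <> i and of W1 of p_i. In the visit of i, the      *)
(* process whose W3 set TURN to i is excluded as well, which gives             *)
(* (n - 1) n + (n - 2) losses.                                                 *)
(* If p_i waited forever, the same count would bound the number of entries.    *)
(* Then DLF would eventually be empty and TURN constant, equal to some k, so   *)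
(* that p_k, or p_i if FLAG[k] remains down, would leave the loop and reach    *)
(* DLF.lock.                                                                   *)

Set Implicit Arguments.
Unset Strict Implicit.
Unset Printing Implicit Defensive.

(** The counting argument is carried out on an abstract system in which a process is only a control
    point ([pc]), moving along [trans]. What it requires of the rest is mutual exclusion on [dcrit],
    progress of DLF.lock, and correct values for reads that overlap no write. Two facts drive it. By
    [turn_read_current], an exiting process that has read TURN holds its current value until its W3
    ends, so TURN only moves by cyclic increments; by [no_turn_past] and [dist_turn], after one
    entry it can only approach i. Hence two entries that see the same value of TURN have no change
    of TURN between them ([tv_same]), and not even a W3 in progress ([no_turn_write]). Each loss
    outside the interrupting writes gets a label: the value k of TURN, together with the winner if
    p_k waits, or [None] if FLAG[k] is down. Labels are distinct ([label_inj]): a winner cannot pass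
    the loop again while TURN is k and FLAG[k] is up ([loop_blocked]), and a winner that finds
    FLAG[k] down moves TURN ([flag_up_R4]). Counting labels gives [at_most_counted]; uniqueness of
    the W1 of p_k in a visit gives [at_most_interrupting]. The same bounds yield termination of the
    wait in [waiting_ends]. Finally [simulation] and [dlf_run] turn a run of Algorithm B into one of
    DLF, which supplies mutual exclusion and progress; safety of the registers supplies the values
    read. *)

Lemma at_most_weaken (T : eqType) m (Q Q' : T -> Prop) :
  (forall x, Q' x -> Q x) -> at_most m Q -> at_most m Q'.
Proof. by move=> QQ' [s sm sQ]; exists s => // x /QQ' /sQ. Qed.

(** Counting by injective labels. The predicate [Q] is not decidable, so the list is built
    classically, with at most one element chosen for each label. Labels form a relation because some
    of them are only known to exist. *)
Lemma at_most_label (T : eqType) (F : finType) (lab : T -> F -> Prop)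
    (L : {set F}) m (Q : T -> Prop) :
  #|L| <= m ->
  (forall x, Q x -> exists2 l, l \in L & lab x l) ->
  (forall l x y, Q x -> Q y -> lab x l -> lab y l -> x = y) ->
  at_most m Q.
Proof.
move=> Lm Qlab lab_inj.
have [s ss sQ] : exists2 s : seq T, size s <= size (enum L) &
    forall x l, Q x -> lab x l -> l \in enum L -> x \in s.
  elim: (enum L) => [|l e [s ss sQ]]; first by exists [::].
  have [[x [Qx xl]]|no] := classic (exists x, Q x /\ lab x l).
    exists (x :: s) => // y k Qy yk; rewrite !inE => /orP[/eqP kl|ke].
      by rewrite kl in yk; rewrite (lab_inj _ _ _ Qy Qx yk xl) eqxx.
    by rewrite (sQ _ _ Qy yk ke) orbT.
  exists s => [|y k Qy yk]; first exact: leqW.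
  rewrite inE => /orP[/eqP kl|]; last exact: sQ.
  by case: no; exists y; rewrite -kl.
exists s => [|x Qx]; first by rewrite (leq_trans ss)// -cardE.
have [l lL xl] := Qlab _ Qx; apply: sQ Qx xl _; by rewrite mem_enum.
Qed.

Lemma least_witness (P : nat -> Prop) (a t : nat) : a <= t -> P t ->
  exists b, [/\ a <= b <= t, P b & forall u, a <= u < b -> ~ P u].
Proof.
elim/ltn_ind: t => t IH at_ Pt.
have [[u [/andP[au ut] Pu]]|no] := classic (exists u, a <= u < t /\ P u).
  by have [b [ab Pb nb]] := IH u ut au Pu; exists b; split=> //; lia.
by exists t; split=> // [|u ut' Pu]; [rewrite at_ leqnn|case: no; exists u].
Qed.

Lemma all_leq_bound (s : seq nat) : exists m, forall x, x \in s -> x <= m.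
Proof.
exists (\max_(x <- s) x) => x xs; exact: leq_bigmax_seq.
Qed.

(** Dependent choice along an invariant. It assembles the one-step simulation, which is a mere
    existence statement, into an infinite run. *)
Lemma invariant_choice (S : Type) (I : nat -> S -> Prop)
    (R : nat -> S -> S -> Prop) (s0 : S) : I 0 s0 ->
  (forall t s, I t s -> exists s', I t.+1 s' /\ R t s s') ->
  exists f, f 0 = s0 /\ forall t, I t (f t) /\ R t (f t) (f t.+1).
Proof.
move=> I0 step.
pose next t (s : {s | I t s}) : {s' | I t.+1 s' /\ R t (sval s) s'} :=
  constructive_indefinite_description _ (step t (sval s) (svalP s)).
pose fix f t : {s | I t s} :=
  match t with
  | 0 => exist _ s0 I0
  | t.+1 => exist _ (sval (next t (f t))) (proj1 (svalP (next t (f t))))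
  end.
exists (fun t => sval (f t)); split=> // t; split; first exact: svalP.
exact: (proj2 (svalP (next t (f t)))).
Qed.

(* The control point of a process. The boolean of R1, R2, R3, R4 and W3 tells  *)
(* whether the operation is in progress, that of DL (DLF.lock) and DU          *)
(* (DLF.unlock) whether DLF has taken its first step. W1 and W2 are always in  *)
(* progress, since a lock or an unlock starts with its first event.            *)
Inductive pc (n : nat) : Type :=
| Rem | W1 | R1 of bool | R2 of bool & 'I_n | DL of bool
| Cs | W2 | R3 of bool | R4 of bool & 'I_n | W3 of bool & 'I_n | DU of bool.
Arguments Rem {n}.
Arguments W1 {n}.
Arguments R1 {n} b.
Arguments DL {n} b.
Arguments Cs {n}.
Arguments W2 {n}.
Arguments R3 {n} b.
Arguments DU {n} b.

Inductive act (n : nat) : Type :=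
| FlagWS of 'I_n & bool | FlagWE of 'I_n | FlagRS of 'I_n | FlagRE of 'I_n & bool
| TurnWS of 'I_n | TurnWE | TurnRS | TurnRE of 'I_n | Other.
Arguments TurnWE {n}.
Arguments TurnRS {n}.
Arguments Other {n}.

Inductive trans (n : nat) (j : 'I_n) : pc n -> act n -> pc n -> Prop :=
| T_W1s : trans j Rem (FlagWS j true) W1
| T_W1e : trans j W1 (FlagWE j) (R1 false)
| T_R1s : trans j (R1 false) TurnRS (R1 true)
| T_R1e k : trans j (R1 true) (TurnRE k) (R2 false k)
| T_R2own : trans j (R2 false j) Other (DL false)
| T_R2s k : k <> j -> trans j (R2 false k) (FlagRS k) (R2 true k)
| T_R2up k : trans j (R2 true k) (FlagRE k true) (R1 false)
| T_R2down k : trans j (R2 true k) (FlagRE k false) (DL false)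
| T_DL b : trans j (DL b) Other (DL true)
| T_DLe b : trans j (DL b) Other Cs
| T_W2s : trans j Cs (FlagWS j false) W2
| T_W2e : trans j W2 (FlagWE j) (R3 false)
| T_R3s : trans j (R3 false) TurnRS (R3 true)
| T_R3e k : trans j (R3 true) (TurnRE k) (R4 false k)
| T_R4s k : trans j (R4 false k) (FlagRS k) (R4 true k)
| T_R4up k : trans j (R4 true k) (FlagRE k true) (DU false)
| T_R4down k : trans j (R4 true k) (FlagRE k false) (W3 false k)
| T_W3s k : trans j (W3 false k) (TurnWS (ordS k)) (W3 true k)
| T_W3e k : trans j (W3 true k) TurnWE (DU false)
| T_DU b : trans j (DU b) Other (DU true)
| T_DUe b : trans j (DU b) Other Rem.

(** * Runs in terms of control points *)

Section Model.
Variable n : nat.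
Implicit Types (p : pc n) (i j k q : 'I_n) (s t u v w e : nat).

Definition up p :=
  match p with R1 _ | R2 _ _ | DL _ | Cs => true | _ => false end.
Definition down p :=
  match p with Rem | R3 _ | R4 _ _ | W3 _ _ | DU _ => true | _ => false end.
Definition waiting p :=
  match p with R1 _ | R2 _ _ | DL _ => true | _ => false end.
(** The control points that DLF sees as its critical section. [DU false] is among them, since
    DLF.unlock has not taken its first step there. *)
Definition dcrit p :=
  match p with
  | Cs | W2 | R3 _ | R4 _ _ | W3 _ _ | DU false => true
  | _ => false
  end.
Definition up_to_R4 p :=
  match p with Cs | W2 | R3 _ | R4 _ _ => true | _ => false end.

(* [cp t j] and [tv t] are the control point of p_j and the value of TURN just *)
(* before time [t]; [tv] changes when W3 ends.                                 *)
Variables (cp : nat -> 'I_n -> pc n) (ev : nat -> option ('I_n * act n))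
  (tv : nat -> 'I_n).

Definition quiet j s e := forall u a, s < u < e -> ev u <> Some (j, a).

Definition enters j t := cp t j <> Cs /\ cp t.+1 j = Cs.

Hypothesis cp0 : forall j, cp 0 j = Rem.
Hypothesis cp_step : forall t,
  match ev t with
  | Some (j, a) => trans j (cp t j) a (cp t.+1 j) /\
                   forall j', j' <> j -> cp t.+1 j' = cp t j'
  | None => forall j, cp t.+1 j = cp t j
  end.
Hypothesis fair : forall j t, cp t j <> Rem ->
  exists2 t', t <= t' & exists a, ev t' = Some (j, a).
Hypothesis mutex : forall t j k, dcrit (cp t j) -> dcrit (cp t k) -> j = k.
Hypothesis dlf : forall t j, cp t j = DL true ->
  exists2 t', t <= t' & exists k, enters k t'.
Hypothesis tvS : forall t, tv t.+1 =
  if ev t is Some (j, TurnWE) then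
    if cp t j is W3 true k then ordS k else tv t
  else tv t.
Hypothesis read_flag_up : forall j k b s e, s < e ->
  ev s = Some (j, FlagRS k) -> ev e = Some (j, FlagRE k b) -> quiet j s e ->
  (forall u, s < u <= e -> up (cp u k)) -> b = true.
Hypothesis read_flag_down : forall j k b s e, s < e ->
  ev s = Some (j, FlagRS k) -> ev e = Some (j, FlagRE k b) -> quiet j s e ->
  (forall u, s < u <= e -> down (cp u k)) -> b = false.
Hypothesis read_turn : forall j k s e, s < e ->
  ev s = Some (j, TurnRS) -> ev e = Some (j, TurnRE k) -> quiet j s e ->
  (forall u q x, s < u <= e -> cp u q <> W3 true x) -> k = tv s.

Lemma cp_idle t j : (forall a, ev t <> Some (j, a)) -> cp t.+1 j = cp t j.
Proof.
move=> no; move: (cp_step t); case E: (ev t) => [[k a]|] //.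
by case=> _; apply=> jk; apply: (no a); rewrite E jk.
Qed.

Lemma cp_trans t j a : ev t = Some (j, a) -> trans j (cp t j) a (cp t.+1 j).
Proof. by move=> E; move: (cp_step t); rewrite E => -[]. Qed.

Lemma cpP t j : cp t.+1 j = cp t j /\ (forall a, ev t <> Some (j, a)) \/
  exists2 a, ev t = Some (j, a) & trans j (cp t j) a (cp t.+1 j).
Proof.
have [[a E]|no] := classic (exists a, ev t = Some (j, a)).
  by right; exists a => //; apply: cp_trans.
have no' a : ev t <> Some (j, a) by move=> E; apply: no; exists a.
by left; split=> //; apply: cp_idle.
Qed.

Lemma last_event e j : cp e j <> Rem ->
  exists s a, [/\ s < e, ev s = Some (j, a), quiet j s e,
    trans j (cp s j) a (cp e j) & forall u, s < u <= e -> cp u j = cp e j].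
Proof.
elim: e => [|e IH]; first by rewrite cp0.
have [[E no]|[a E tr]] := cpP e j.
  rewrite E => /IH[s [a [se Es qt tr ct]]]; exists s, a; split=> //.
  - exact: leqW.
  - move=> u b /andP[su ue]; have [->|ue'] := eqVneq u e; first exact: no.
    by apply: qt; lia.
  - move=> u /andP[su ue]; have [->|ue'] := eqVneq u e.+1; first exact: E.
    by apply: ct; lia.
move=> _; exists e, a; split=> //; first by move=> u b; lia.
by move=> u ue; have -> : u = e.+1 by lia.
Qed.

Lemma next_event t j : cp t j <> Rem ->
  exists s a, [/\ t <= s, ev s = Some (j, a), trans j (cp t j) a (cp s.+1 j),
    (forall u, t <= u <= s -> cp u j = cp t j) &
    forall u b, t <= u < s -> ev u <> Some (j, b)].
Proof.
move=> /fair[t' tt' H].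
have [s [/andP[ts _] [a Es] no]] :=
  @least_witness (fun t' => exists a, ev t' = Some (j, a)) _ _ tt' H.
have ct u : t <= u <= s -> cp u j = cp t j.
  elim: u => [|u IH] us; first by have -> : t = 0 by lia.
  have [<- //|tu] := eqVneq t u.+1.
  rewrite cp_idle ?IH //; first by lia.
  by move=> b Eb; apply: (no u); [lia|exists b].
exists s, a; split=> //.
  by rewrite -(ct s) ?leqnn ?ts //; apply: cp_trans.
by move=> u b us Eu; apply: (no u us); exists b.
Qed.

Lemma event_start u e j : cp e j <> Rem -> u <= e -> cp u j <> cp e j ->
  exists s a, [/\ u <= s < e, ev s = Some (j, a), quiet j s e,
    trans j (cp s j) a (cp e j) & forall w, s < w <= e -> cp w j = cp e j].
Proof.
move=> nr ue uj; have [s [a [se Es qt tr ct]]] := last_event nr.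
exists s, a; split=> //; rewrite se andbT leqNgt; apply/negP=> su.
by apply: uj; apply: ct; rewrite su.
Qed.

Lemma flag_read_start j k b u e : ev e = Some (j, FlagRE k b) -> u <= e ->
  cp u j <> cp e j ->
  exists s, [/\ u <= s < e, ev s = Some (j, FlagRS k), quiet j s e &
    forall w, s < w <= e -> cp w j = cp e j].
Proof.
move=> /cp_trans te ue uj.
have ce : cp e j = R2 true k \/ cp e j = R4 true k by inversion te; auto.
have [|s [a [us Es qt tr ct]]] := @event_start u e j _ ue uj.
  by case: ce => ->.
exists s; split=> //; rewrite Es.
by case: ce => ce; rewrite ce in tr; inversion tr.
Qed.

(** A time [u] at which p_j is not at the control point of this read bounds the start of the read
    from below, so the flag has to be controlled only at later instants when the read is in
    progress. *)
Lemma flag_up_clean j k b u e : ev e = Some (j, FlagRE k b) -> u <= e ->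
  cp u j <> cp e j ->
  (forall w, u < w <= e -> cp w j = cp e j -> up (cp w k)) -> b = true.
Proof.
move=> E ue uj upk; have [s [us Es qt ct]] := flag_read_start E ue uj.
apply: (read_flag_up _ Es E qt) => [|w sw]; first by lia.
by apply: upk; [lia|exact: ct].
Qed.

Lemma flag_down_clean j k b u e : ev e = Some (j, FlagRE k b) -> u <= e ->
  cp u j <> cp e j ->
  (forall w, u < w <= e -> cp w j = cp e j -> down (cp w k)) -> b = false.
Proof.
move=> E ue uj upk; have [s [us Es qt ct]] := flag_read_start E ue uj.
apply: (read_flag_down _ Es E qt) => [|w sw]; first by lia.
by apply: upk; [lia|exact: ct].
Qed.

Lemma turn_clean j k u e : ev e = Some (j, TurnRE k) -> u <= e ->
  cp u j <> cp e j ->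
  (forall w q x, u < w <= e -> cp w j = cp e j -> cp w q <> W3 true x) ->
  exists s, [/\ u <= s < e, k = tv s & forall w, s < w <= e -> cp w j = cp e j].
Proof.
move=> E ue uj noW; have te := cp_trans E.
have ce : cp e j = R1 true \/ cp e j = R3 true by inversion te; auto.
have [|s [a [us Es qt tr ct]]] := @event_start u e j _ ue uj.
  by case: ce => ->.
have Ea : a = TurnRS by case: ce => ce; rewrite ce in tr; inversion tr.
subst a; exists s; split=> //.
apply: (read_turn _ Es E qt) => [|w q x sw]; first by lia.
by apply: noW; [lia|exact: ct].
Qed.

Lemma tv_step t : tv t.+1 = tv t \/ exists q k,
  [/\ ev t = Some (q, TurnWE), cp t q = W3 true k, cp t.+1 q = DU false
    & tv t.+1 = ordS k].
Proof.
rewrite tvS; case E: (ev t) => [[q []]|]; try by left.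
have te := cp_trans E; inversion te; right; exists q, k; split=> //.
Qed.

Lemma tv_const s e : s <= e ->
  (forall w q x, s <= w < e -> cp w q <> W3 true x) -> tv e = tv s.
Proof.
elim: e => [|e IH] se no; first by have -> : s = 0 by lia.
have [<- //|se'] := eqVneq s e.+1.
rewrite -IH; [|by lia|by move=> w q x we; apply: no; lia].
have [//|[q [k [_ H _ _]]]] := tv_step e.
by case: (no e q k) => //; lia.
Qed.

Lemma turn_read_current t q b k :
  cp t q = R4 b k \/ cp t q = W3 b k -> k = tv t.
Proof.
elim: t q b k => [|t IH] q b k; first by rewrite cp0 => -[].
move=> Eq.
have [[E no]|[a E tr]] := cpP t q.
  have [->|[q' [k' [E' W _ _]]]] := tv_step t.
    by apply: (IH q b); rewrite -E.
  suff qq' : q = q' by subst q'; case: (no _ E').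
  apply: (@mutex t); last by rewrite W.
  by rewrite -E; case: Eq => ->.
have tvE : a <> TurnWE -> tv t.+1 = tv t.
  move=> na; have [//|[q' [k' [E' _ _ _]]]] := tv_step t.
  by move: E'; rewrite E => -[_ /na].
case: Eq => Eq; rewrite Eq in tr; inversion tr; subst; rewrite tvE //.
(* The read R3 ends here: it returns the value of TURN at its start, which mutual exclusion keeps
   unchanged up to [t]. *)
- have E0 : cp t q = R3 true by [].
  have [|||s [/andP[_ st'] -> ct]] := @turn_clean q k 0 t E => //.
  + by rewrite cp0 E0.
  + move=> w q' x wt wq W; have qq' : q' = q.
      by apply: (@mutex w); rewrite ?W // wq E0.
    by subst q'; rewrite wq E0 in W.
  have sr : cp s.+1 q = R3 true by rewrite ct ?E0 //; lia.
  have cs : cp s q = R3 true \/ cp s q = R3 false.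
    have [[E' _]|[a' _ tr']] := cpP s q; first by left; rewrite -E'.
    by right; rewrite sr in tr'; inversion tr'.
  symmetry; apply: tv_const; first by lia.
  move=> w q' x wt W.
  have cw : cp w q = R3 true \/ cp w q = R3 false.
    by have [->//|ws] := eqVneq w s; left; rewrite ct ?E0 //; lia.
  have qq' : q' = q by apply: (@mutex w); [rewrite W|case: cw => ->].
  by subst q'; case: cw; rewrite W.
- by apply: (IH q false); left.
- by apply: (IH q true); left.
- by apply: (IH q false); right.
Qed.


Lemma enters_DL j t : enters j t -> exists b, cp t j = DL b.
Proof.
move=> [nc ct]; have [[E _]|[a _ tr]] := cpP t j.
  by case: nc; rewrite -E.
by rewrite ct in tr; inversion tr; exists b.
Qed.

(** The entering process is in DLF's critical section just after [t], and the others do not move at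
    [t]. So every exit begun before an entry is past W3 by the time of that entry. *)
Lemma enters_ndcrit j t q : enters j t -> ~~ dcrit (cp t q).
Proof.
move=> jt; have [b Eb] := enters_DL jt; case: jt => _ jt.
have [->|/eqP qj] := eqVneq q j; first by rewrite Eb.
apply/negP => dq; apply: (qj); apply: (@mutex t.+1); last by rewrite jt.
have [[-> _]//|[a E _]] := cpP t q.
move: (cp_step t); rewrite E => -[_ H].
by rewrite (H j (nesym qj)) Eb in jt.
Qed.

Lemma enters_inj j k t : enters j t -> enters k t -> j = k.
Proof. by move=> [_ jt] [_ kt]; apply: (@mutex t.+1); rewrite ?jt ?kt. Qed.

(** The number of increments modulo n that lead from x to i. *)
Definition dist_ord (i x : 'I_n) := if x <= i then i - x else i + n - x.

Lemma dist_ordS (i x : 'I_n) : x <> i -> dist_ord i (ordS x) < dist_ord i x.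
Proof.
move=> xi; have {}xi : nat_of_ord x <> i by move=> H; apply: xi; apply: val_inj.
have := ltn_ord x; have := ltn_ord i.
rewrite /dist_ord /= => hi hx.
have [E|E] := eqVneq x.+1 n.
  by rewrite E modnn leq0n; case: (leqP x i) => ?; lia.
rewrite modn_small; last by lia.
by case: (leqP x.+1 i) => ?; case: (leqP x i) => ?; lia.
Qed.

Definition outside_loop p :=
  match p with R1 true | R2 _ _ | DL _ => false | _ => true end.

(** Every R1 begun from [u] on returns k, which differs from j, and every following R2 finds FLAG[k]
    up, so p_j keeps returning to R1. *)
Lemma loop_blocked j k u t b : u <= t -> j <> k -> outside_loop (cp u j) ->
  (forall v, u <= v <= t -> tv v = k) ->
  (forall v q x, u < v <= t -> cp v q <> W3 true x) ->
  (forall v, u < v <= t -> up (cp v k)) -> cp t j <> DL b.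
Proof.
move=> ut jk ou tk noW upk.
suff: match cp t j return Prop with
  | R2 _ x => x = k | DL _ => False | _ => True end.
  by case: (cp t j).
elim: t ut tk noW upk => [|t IH] ut tk noW upk.
  by have E : u = 0 by [lia]; move: ou; rewrite E; case: (cp 0 j).
have [E|ut'] := eqVneq u t.+1; first by move: ou; rewrite E; case: (cp _ j).
have {IH} := IH ltac:(lia) (fun v H => tk v ltac:(lia))
  (fun v q x H => noW v q x ltac:(lia)) (fun v H => upk v ltac:(lia)).
have [[-> _]//|[a Ea tr]] := cpP t j.
move: tr; move E: (cp t j) => p tr; case: tr E Ea => //=.
- move=> x E Ea _.
  have [||w q y H _|s [us -> _]] := turn_clean Ea (u := u); first by lia.
  + by move=> H; rewrite H E in ou.
  + by apply: noW; lia.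
  by apply: tk; lia.
- move=> x E Ea xk; suff: false = true by [].
  apply: (flag_up_clean Ea (u := u)) => [||w H _]; first by lia.
    by move=> H; rewrite H E in ou.
  by rewrite xk; apply: upk; lia.
Qed.

(** * Entries while p_i waits *)

Section Waiting.
Variables (i : 'I_n) (e0 : nat).

Definition waits_until t := forall u, e0 < u <= t -> waiting (cp u i).

Lemma waiting_up p : waiting p -> up p.
Proof. by case: p. Qed.

Lemma waits_le u t : u <= t -> waits_until t -> waits_until u.
Proof. by move=> ut wt v vu; apply: wt; lia. Qed.

(* Whoever tests FLAG[i] in R4 after an entry started its critical section no *)
(* earlier than that entry, hence it reads the flag while it is up.           *)
Lemma no_turn_past j t u q b : e0 < t -> enters j t -> t <= u ->
  waits_until u -> cp u q <> W3 b i.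
Proof.
move=> e0t jt; elim/ltn_ind: u q b => u IH q b tu wu Eq.
have qt : cp t q <> cp u q.
  by move=> H; move: (enters_ndcrit q jt); rewrite H Eq.
have [|s [a [us Es qs tr ct]]] := @event_start t u q _ tu qt.
  by rewrite Eq.
rewrite Eq in tr; inversion tr; subst.
  have E4 : cp s q = R4 true i by [].
  suff: false = true by [].
  apply: (flag_up_clean Es (u := t)) => [||w tw _]; first by lia.
    by move=> H; move: (enters_ndcrit q jt); rewrite H E4.
  by apply/waiting_up/wu; lia.
have E4 : cp s q = W3 false i by [].
by apply: (IH s _ q false) => //; [lia|lia|apply: waits_le wu; lia].
Qed.

(** TURN is only incremented, and never away from i by [no_turn_past]; each value is therefore held
    during a single interval of time. *)
Lemma dist_turn j t u v : e0 < t -> enters j t -> t <= u -> u <= v ->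
  waits_until v -> tv v = tv u \/ dist_ord i (tv v) < dist_ord i (tv u).
Proof.
move=> e0t jt tu; elim: v => [|v IH] uv wv; first by left; congr tv; lia.
have [->|uv'] := eqVneq u v.+1; first by left.
have {}IH := IH _ (waits_le (leqnSn v) wv).
have [->|[q [k [_ E _ H]]]] := tv_step v; first by apply: IH; lia.
have kv : k = tv v by apply: (@turn_read_current _ q true); right.
have ki : k <> i.
  move=> ki; rewrite ki in E.
  by apply: (no_turn_past e0t jt _ (waits_le (leqnSn v) wv) E); lia.
rewrite H; right; have := dist_ordS ki; rewrite {2}kv.
by case: IH => [|->|]; lia.
Qed.

(** * Two entries that see the same value k of TURN *)

Section SameTurn.
Variables (j1 j2 : 'I_n) (t1 t2 : nat).
Hypotheses (e0t1 : e0 < t1) (t12 : t1 < t2).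
Hypotheses (ent1 : enters j1 t1) (ent2 : enters j2 t2) (w2 : waits_until t2).
Hypothesis tv12 : tv t1 = tv t2.
Let k := tv t1.

Lemma tv_same u : t1 <= u <= t2 -> tv u = k.
Proof.
move=> /andP[tu ut].
have wu := waits_le ut w2.
have [//|] := dist_turn e0t1 ent1 (leqnn _) tu wu.
have [E|] := dist_turn e0t1 ent1 tu ut w2.
  by rewrite -tv12 in E; rewrite E; lia.
by rewrite tv12; lia.
Qed.

(** Such a W3 would have to end before [t2], when nobody is in DLF's critical section, and its end
    would change TURN. *)
Lemma no_turn_write u q b x : t1 <= u <= t2 -> cp u q <> W3 b x.
Proof.
move=> tu E.
have all v : u <= v <= t2 -> exists c y, cp v q = W3 c y.
  elim: v => [|v IH] uv; first by exists b, x; rewrite -E; congr cp; lia.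
  have [<-|uv'] := eqVneq u v.+1; first by exists b, x.
  have [|c [y Ec]] := IH; first by lia.
  have [[-> _]|[a Ea tr]] := cpP v q; first by exists c, y.
  rewrite Ec in tr; inversion tr; subst; first by exists true, y.
  have [tS|[q' [y' [E1 E2 E3 E4]]]] := tv_step v.
    move: tS; rewrite tvS Ea Ec => yy.
    have ey : y = tv v by apply: (@turn_read_current _ q true); right.
    have yi : y <> i.
      move=> yi; rewrite yi in Ec.
      apply: (no_turn_past e0t1 ent1 _ _ Ec); first by lia.
      by apply: waits_le w2; lia.
    by have := dist_ordS yi; rewrite yy -ey; lia.
  have ey : y' = tv v by apply: (@turn_read_current _ q' true); right.
  have yi : y' <> i.
    move=> yi; rewrite yi in E2.
    apply: (no_turn_past e0t1 ent1 _ _ E2); first by lia.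
    by apply: waits_le w2; lia.
  have := dist_ordS yi; rewrite -E4 ey.
  by rewrite !tv_same; lia.
have [|c [y Ec]] := all t2; first by lia.
by have := enters_ndcrit q ent2; rewrite Ec.
Qed.

(** p_j must complete its exit code before [t2]. If FLAG[k] were down during its R4, that read would
    return 0 and lead to W3, which is excluded. *)
Lemma flag_up_R4 j t : t1 <= t < t2 -> enters j t ->
  ~ (forall u, t < u <= t2 -> cp u j = R4 true k -> down (cp u k)).
Proof.
move=> tt jt dk.
suff all u : t < u <= t2 -> up_to_R4 (cp u j).
  have := enters_ndcrit j ent2; have := all t2.
  by case: (cp t2 j) => //=; (try by move=> H; have := H ltac:(lia)); lia.
elim: u => [|u IH] tu; first by lia.
have [<-|tu'] := eqVneq t u; first by case: jt => _ ->.
have [|] := cpP u j; first by case=> -> _; apply: IH; lia.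
case=> a Ea tr; have := IH ltac:(lia).
have := @no_turn_write u.+1 j false; move: tr.
move E: (cp u j) => p; move E': (cp u.+1 j) => p' tr.
case: tr E E' Ea => //= x E E' Ea; last by move/(_ x); case=> //; lia.
move=> _ _; have xk : x = k.
  by rewrite -(@tv_same u); [apply: (@turn_read_current _ j true); left|lia].
subst x; suff: true = false by [].
apply: (flag_down_clean Ea (u := t)) => [||w tw Ew]; first by lia.
  by have [b ->] := enters_DL jt; rewrite E.
by apply: dk; [lia|rewrite Ew].
Qed.

(** p_k would test its own flag in R4 after resetting it in W2. *)
Lemma no_entry_turn t : t1 <= t < t2 -> ~ enters k t.
Proof. by move=> tt kt; apply: (flag_up_R4 tt kt) => u _ ->. Qed.

Lemma turn_waiting u v : t1 <= u -> u <= v -> v <= t2 ->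
  waiting (cp u k) -> waiting (cp v k).
Proof.
move=> tu; elim: v => [|v IH] uv vt wu; first by have <- : u = 0 by lia.
have [<- //|uv'] := eqVneq u v.+1.
have {IH} := IH ltac:(lia) ltac:(lia) wu.
have [[-> _]//|[a _]] := cpP v k.
have := @no_entry_turn v ltac:(lia); rewrite /enters.
move E: (cp v k) => p; move E': (cp v.+1 k) => p' H tr.
by case: tr H {E E'} => // b []; split.
Qed.

(** Once its W1 has ended, p_k waits, and it still waits at [t2] because it cannot enter before. A
    single W1 thus covers both entries, which is what bounds the number of interrupting writes. *)
Lemma turn_W1 u : cp t1 k = W1 -> cp t2 k = W1 -> t1 <= u <= t2 -> cp u k = W1.
Proof.
move=> k1 k2; elim: u => [|u IH] tu; first by have <- : t1 = 0 by lia.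
have [<- //|tu'] := eqVneq t1 u.+1.
have {IH} := IH ltac:(lia).
have [[-> _]//|[a _ tr]] := cpP u k; move=> E; rewrite E in tr.
have := @turn_waiting u.+1 t2 ltac:(lia) ltac:(lia) (leqnn _).
by rewrite k2; inversion tr => /(_ isT).
Qed.

Lemma turn_Rem_down u : down (cp t1 k) -> down (cp t2 k) -> t1 <= u <= t2 ->
  down (cp u k).
Proof.
move=> k1 k2; elim: u => [|u IH] tu; first by have <- : t1 = 0 by lia.
have [<- //|tu'] := eqVneq t1 u.+1.
have {IH} := IH ltac:(lia).
have [[-> _]//|[a _ tr]] := cpP u k.
move E': (cp u.+1 k) tr => p' tr.
case: tr E' => //= E' _; exfalso.
(* FLAG[k] can cease to be settled at 0 only by a new W1 of p_k; unable to enter, p_k would then be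
   in W1 or waiting at [t2]. *)
suff all v : u < v <= t2 -> cp v k = W1 \/ waiting (cp v k).
  have [H|] := all t2 ltac:(lia); first by rewrite H in k2.
  by case: (cp t2 k) k2.
elim: v => [|v IH] uv; first by lia.
have [<-|uv'] := eqVneq u v; first by left.
have {IH} := IH ltac:(lia).
have [[-> _]//|[b _]] := cpP v k.
have := @no_entry_turn v ltac:(lia); rewrite /enters.
move F: (cp v k) => p; move F': (cp v.+1 k) => p'' H tr.
by case: tr H {F F'}; (try by right); (try by move=> ? []; split);
  (try by move=> ? ? []); try by move=> ? [].
Qed.

End SameTurn.

(** * Labels of the losses outside interrupting writes *)

Definition counted (x : 'I_n * nat) : Prop :=
  [/\ e0 < x.2, enters x.1 x.2, waits_until x.2, x.1 <> i
    & cp x.2 (tv x.2) <> W1].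

(* At a counted entry with TURN = k, p_k is waiting iff FLAG[k] is up: no      *)
(* process is in DLF's critical section, and [counted] excludes W1.            *)
Definition label (x : 'I_n * nat) : 'I_n * option 'I_n :=
  (tv x.2, if waiting (cp x.2 (tv x.2)) then Some x.1 else None).

Lemma entry_idle j t k : enters j t -> cp t k <> W1 -> ~~ waiting (cp t k) ->
  down (cp t k).
Proof.
by move=> jt; have := enters_ndcrit k jt; case: (cp t k) => //= -[].
Qed.

(** With label [None], FLAG[k] is down from one entry to the other, against [flag_up_R4]. With label
    [Some j], FLAG[k] is up throughout, so [loop_blocked] prevents a second entry of p_j. *)
Lemma label_lt x y : counted x -> counted y -> x.2 < y.2 -> label x <> label y.
Proof.
case: x y => [j t] [j' t'] [/= e0t jt wt ji nW] [/= e0t' jt' wt' ji' nW'] tt'.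
rewrite /label /= => -[tvE].
set k := tv t in nW *; rewrite -tvE in nW' *.
have [wk|nwk] := boolP (waiting (cp t k)); last first.
  case: ifP => // /negbT nwk' _.
  have dk := entry_idle jt nW nwk; have dk' := entry_idle jt' nW' nwk'.
  apply: (flag_up_R4 e0t tt' jt jt' wt' tvE (t := t)) (jt) _; first by lia.
  move=> u tu _; apply: (turn_Rem_down e0t tt' jt jt' wt' tvE) => //; lia.
case: ifP => // wk' [jj']; rewrite -jj' in jt'.
have [b Eb] := enters_DL jt'.
have nE : j <> k.
  move=> jk; apply: (no_entry_turn e0t tt' jt jt' wt' tvE (t := t)); first by lia.
  by rewrite -/k -jk.
apply: (@loop_blocked j k t.+1 t' b tt' nE) Eb.
- by case: jt => _ ->.
- by move=> v vt; apply: (tv_same e0t tt' jt wt' tvE); lia.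
- by move=> v q x vt; apply: (no_turn_write e0t tt' jt jt' wt' tvE); lia.
- move=> v vt; apply: waiting_up.
  by apply: (turn_waiting e0t tt' jt jt' wt' tvE (u := t)) => //; lia.
Qed.

Lemma label_inj l x y : counted x -> counted y -> l = label x -> l = label y ->
  x = y.
Proof.
move=> cx cy lx ly; have [xy|xy|xy] := ltngtP x.2 y.2.
- by case: (label_lt cx cy xy); rewrite -lx.
- by case: (label_lt cy cx xy); rewrite -ly.
case: x y cx cy xy {lx ly} => [j t] [j' t'] [/= _ jt _ _ _] [/= _ jt' _ _ _] tt'.
by rewrite -tt' in jt' *; rewrite (enters_inj jt jt').
Qed.

Lemma turn_stays j t u : e0 < t -> enters j t -> t <= u -> waits_until u ->
  forall v, t <= v <= u -> tv v = i -> tv u = i.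
Proof.
move=> e0t jt tu wu v /andP[tv_ vu] vi.
have [->//|] := dist_turn e0t jt tv_ vu wu.
by rewrite vi /dist_ord leqnn subnn.
Qed.

Lemma at_most_counted : 1 < n -> at_most (n ^ 2 - 2) counted.
Proof.
move=> n1.
(* The labels available while TURN differs from i: n - 1 values of TURN, each with [None] or one of
   the n - 1 winners other than p_i. *)
pose away := setX [set~ i] [set~ Some i].
have away_card : #|away| = n.-1 * n.
  by rewrite cardsX !cardsC1 card_option card_ord.
have awayP x : counted x -> tv x.2 <> i -> label x \in away.
  case=> _ _ _ xi _ /eqP ti; rewrite in_setX !inE ti /=.
  by case: ifP => // _; apply/eqP => -[].
have homeP x : counted x -> tv x.2 = i -> label x = (i, Some x.1).
  by case=> ex _ wx _ _ ti; rewrite /label ti wx //; lia.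
have [[x0 [c0 ti0]]|noaway] := classic (exists x, counted x /\ tv x.2 <> i);
  last first.
  apply: (@at_most_label _ _ (fun x l => l = label x)
    [set (i, Some j) | j in [set~ i]]).
  - rewrite card_imset => [|j j' [] //].
    by rewrite cardsC1 card_ord; nia.
  - move=> x cx; exists (label x) => //.
    have ti : tv x.2 = i by apply: NNPP => ti; apply: noaway; exists x.
    rewrite homeP //; apply: imset_f; rewrite !inE.
    by case: cx => _ _ _ /eqP.
  - exact: label_inj.
have [[x1 [c1 ti1]]|nohome] := classic (exists x, counted x /\ tv x.2 = i);
  last first.
  apply: (@at_most_label _ _ (fun x l => l = label x) away).
  - by rewrite away_card; nia.
  - move=> x cx; exists (label x) => //; apply: awayP => // ti.
    by apply: nohome; exists x.
  - exact: label_inj.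
have [e0t0 ent0 _ _ _] := c0; have [_ _ w1 _ _] := c1.
(* TURN cannot leave i once an entry has occurred, so the losses with TURN = i come after those with
   another value. *)
have after x : counted x -> tv x.2 = i -> x0.2 < x.2.
  move=> cx ti; have [//|xx|xx] := ltngtP x0.2 x.2; last by case: ti0; rewrite xx.
  have [e0t entx _ _ _] := cx; have [_ _ w0 _ _] := c0.
  by case: ti0; apply: (turn_stays e0t entx (ltnW xx) w0 (v := x.2)) => //; lia.
have t01 := after _ c1 ti1.
(* [w] is the time of the event that sets TURN to i. The value is observed one instant later, whence
   the predecessor of [x1.2]. *)
have [w [/andP[t0w wt1] tw minw]] :=
  @least_witness (fun w => tv w.+1 = i) x0.2 x1.2.-1
  ltac:(lia) (etrans (congr1 tv (ltn_predK t01)) ti1).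
have [q [Eq Eq']] : exists q, cp w q = W3 true (tv w) /\ cp w.+1 q = DU false.
  have [tS|[q [k [_ Ek Eq' _]]]] := tv_step w.
    rewrite tw in tS; have [w0|w0] := eqVneq w x0.2; first by case: ti0; rewrite -w0.
    by case: (minw w.-1); rewrite ?prednK //; lia.
  by exists q; rewrite -(turn_read_current (or_intror Ek)).
have stays v : w < v <= x1.2 -> tv v = i.
  move=> wv; apply: (turn_stays e0t0 ent0 _ _ (v := w.+1)) => //; try lia.
  by apply: waits_le w1; lia.
have qi : q != i.
  by apply/eqP => qi; have := w1 w; rewrite -qi Eq => /(_ ltac:(lia)).
(* The process p_q whose W3 set TURN to i is outside the loop when that write ends; from then on
   TURN = i and FLAG[i] is up, so it cannot pass the loop. This saves one label. *)
have home_neq x : counted x -> tv x.2 = i -> x.1 <> q.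
  move=> cx ti xq; have t0x := after _ cx ti.
  have [_ entx wx _ _] := cx.
  have wx' : w < x.2.
    rewrite ltnNge; apply/negP => xw; apply: (minw x.2.-1); first by lia.
    by rewrite prednK //; lia.
  have [b] := enters_DL entx; rewrite xq.
  have stx v : w < v <= x.2 -> tv v = i.
    move=> wv; apply: (turn_stays e0t0 ent0 _ _ (v := w.+1)) => //; try lia.
    by apply: waits_le wx; lia.
  apply: (@loop_blocked q i w.+1) => //.
  - exact/eqP.
  - by rewrite Eq'.
  - move=> v q' y wv Ev.
    have yi : y = i.
      by rewrite (turn_read_current (or_intror Ev)) stx //; lia.
    rewrite yi in Ev; apply: (no_turn_past e0t0 ent0 _ _ Ev); first by lia.
    by apply: waits_le wx; lia.
  - by move=> v wv; apply/waiting_up/wx; lia.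
apply: (@at_most_label _ _ (fun x l => l = label x)
  (away :|: [set (i, Some j) | j in ~: [set i; q]])).
- apply: (@leq_trans (n.-1 * n + (n - 2))); last by nia.
  rewrite (leq_trans (leq_card_setU _ _)) // away_card leq_add2l.
  rewrite card_imset => [|j j' [] //].
  by rewrite cardsCs setCK cards2 card_ord eq_sym qi.
- move=> x cx; exists (label x) => //; rewrite in_setU.
  have [ti|/eqP ti] := eqVneq (tv x.2) i; last by rewrite awayP.
  apply/orP; right; rewrite homeP //; apply: imset_f; rewrite !inE negb_or.
  by apply/andP; split; apply/eqP; [case: cx|exact: home_neq].
- exact: label_inj.
Qed.

(** * The interrupting writes *)

Definition flag_write k (w : nat * nat) : Prop :=
  [/\ w.1 < w.2, ev w.1 = Some (k, FlagWS k true), ev w.2 = Some (k, FlagWE k),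
      quiet k w.1 w.2 & forall u, w.1 < u <= w.2 -> cp u k = W1].

Lemma flag_write_inj k (w w' : nat * nat) u :
  flag_write k w -> flag_write k w' ->
  w.1 < u <= w.2 -> w'.1 < u <= w'.2 -> w = w'.
Proof.
have start (v v' : nat * nat) : flag_write k v -> flag_write k v' ->
    v.1 < u <= v.2 -> v'.1 < u <= v'.2 -> v.1 < v'.1 -> False.
  move=> [_ _ _ _ vW] [_ /cp_trans tr _ _ _] uv uv' vv'.
  by rewrite vW in tr; [inversion tr|lia].
have stop (v v' : nat * nat) : flag_write k v -> flag_write k v' ->
    v.1 = v'.1 -> v.2 < v'.2 -> False.
  move=> [v12 _ Ev _ _] [_ _ _ qt _] vv' v2; apply: (qt v.2 _ _ Ev); lia.
move=> fw fw' uw uw'.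
have E1 : w.1 = w'.1.
  have [H|H|//] := ltngtP w.1 w'.1; first by case: (start w w').
  by case: (start w' w).
have E2 : w.2 = w'.2.
  have [H|H|//] := ltngtP w.2 w'.2; first by case: (stop w w').
  by case: (stop w' w).
by case: w w' E1 E2 {fw fw' uw uw'} => [? ?] [? ?] /= -> ->.
Qed.

Lemma flag_write_at k t : cp t k = W1 ->
  exists w : nat * nat, flag_write k w /\ w.1 < t <= w.2.
Proof.
move=> Ek.
have [|s [a [st Es qs trs cs]]] := @last_event t k; first by rewrite Ek.
have [|e [b [te Ee tre ce ne]]] := @next_event t k; first by rewrite Ek.
rewrite Ek in trs tre; inversion trs; inversion tre; subst.
exists (s, e); split; last by rewrite /= st te.
split=> //=; first exact: leq_trans te.
- move=> u b su; have [ut|tu] := ltnP u t; first by apply: qs; rewrite ut; lia.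
  by apply: ne; lia.
- move=> u su; have [ut|tu] := leqP u t; first by rewrite cs //; lia.
  by rewrite ce //; lia.
Qed.

(** Either the W1 of p_i ending at [e0], or a W1 of p_k in progress at an entry that sees TURN = k;
    only during such a write may a read of FLAG[k] be arbitrary without the loss being labelled. *)
Definition interrupting (w : nat * nat) : Prop :=
  flag_write i w /\ w.2 = e0 \/
  exists k x, [/\ k <> i, flag_write k w, w.1 < x.2 <= w.2 &
    [/\ e0 < x.2, enters x.1 x.2, waits_until x.2 & tv x.2 = k]].

Lemma at_most_interrupting : at_most n interrupting.
Proof.
pose lab (w : nat * nat) k := flag_write k w /\ (k = i /\ w.2 = e0 \/ exists x,
  [/\ k <> i, w.1 < x.2 <= w.2 &
    [/\ e0 < x.2, enters x.1 x.2, waits_until x.2 & tv x.2 = k]]).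
apply: (@at_most_label _ _ lab setT); first by rewrite cardsT card_ord.
  move=> w [[fw we]|[k [x [ki fw xw H]]]].
    by exists i; rewrite ?inE //; split=> //; left.
  by exists k; rewrite ?inE //; split=> //; right; exists x.
move=> k w w' _ _ [fw [[ki we]|[x [ki xw [e0x ex wx tx]]]]]
  [fw' [[ki' we']|[x' [ki' xw' [e0x' ex' wx' tx']]]]] //.
  apply: (flag_write_inj (u := e0) fw fw').
  - by case: fw => H _ _ _ _; rewrite we in H *; rewrite H leqnn.
  - by case: fw' => H _ _ _ _; rewrite we' in H *; rewrite H leqnn.
(* By [turn_W1], p_k is in W1 from one entry to the other, so the first write is still going on at
   the second entry. *)
have same (v v' : nat * nat) (y y' : 'I_n * nat) :
    flag_write k v -> flag_write k v' ->
    v.1 < y.2 <= v.2 -> v'.1 < y'.2 <= v'.2 -> y.2 < y'.2 -> e0 < y.2 ->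
    enters y.1 y.2 -> enters y'.1 y'.2 -> waits_until y'.2 ->
    tv y.2 = k -> tv y'.2 = k -> v = v'.
  move=> fv fv' yv yv' yy e0y ey ey' wy ty ty'.
  have kk : tv y.2 = tv y'.2 by rewrite ty.
  have W u : y.2 <= u <= y'.2 -> cp u k = W1.
    rewrite -ty; apply: (turn_W1 e0y yy ey ey' wy kk); rewrite ty.
      by case: fv => _ _ _ _; apply.
    by case: fv' => _ _ _ _; apply.
  apply: (flag_write_inj (u := y'.2) fv fv') => //.
  have [|lt] := leqP y'.2 v.2; first by lia.
  case: fv => _ _ /cp_trans tr _ _.
  by rewrite !W in tr; try lia; inversion tr.
have [H|H|H] := ltngtP x.2 x'.2.
- exact: (same w w' x x').
- by symmetry; apply: (same w' w x' x).
- by apply: (flag_write_inj (u := x.2) fw fw') => //; rewrite H.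
Qed.

Lemma entry_counted_or_interrupted x :
  e0 < x.2 -> enters x.1 x.2 -> waits_until x.2 -> x.1 <> i ->
  (forall w : nat * nat, interrupting w -> ~ (w.1 <= x.2 <= w.2)) -> counted x.
Proof.
move=> e0x ex wx xi nw; split=> // /flag_write_at[w [fw xw]].
apply: (nw w); last by lia.
right; exists (tv x.2), x; split=> // ti.
case: fw => _ _ _ _ /(_ x.2 xw); rewrite ti.
by have := wx x.2 ltac:(lia); case: (cp x.2 i).
Qed.

End Waiting.

(** * p_i does not wait forever *)

Lemma enters_preserve_ndcrit T : (forall j t, T <= t -> ~ enters j t) ->
  forall q u v, T <= u -> u <= v -> ~~ dcrit (cp u q) -> ~~ dcrit (cp v q).
Proof.
move=> noE q u v Tu; elim: v => [|v IH] uv nu; first by have <- : u = 0 by lia.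
have [<-//|uv'] := eqVneq u v.+1.
have {IH} := IH ltac:(lia) nu; have := noE q v ltac:(lia).
have [[-> _]//|[a _]] := cpP v q; rewrite /enters.
move E: (cp v q) => p; move E': (cp v.+1 q) => p' tr H.
by case: tr H {E E'} => //= b []; split.
Qed.

Lemma leaves_dcrit q t : exists2 u, t <= u & ~~ dcrit (cp u q).
Proof.
pose rank p := match p : pc n with
  | Cs => 9 | W2 => 8 | R3 b => if b then 6 else 7
  | R4 b _ => if b then 4 else 5 | W3 b _ => if b then 2 else 3
  | DU false => 1 | _ => 0 end.
elim/ltn_ind: {t}(rank _) {-2}t (erefl (rank (cp t q))) => r IH t Er.
have [dq|] := boolP (dcrit (cp t q)); last by exists t.
have [|s [a [ts _ tr _ _]]] := @next_event t q; first by case: (cp t q) dq.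
have [|u su nu] := IH (rank (cp s.+1 q)) _ s.+1 erefl; last by exists u; lia.
rewrite -Er; move: dq tr; case: (cp t q) => //= [||[]|[] ?|[] ?|[]] // _ tr;
  by inversion tr.
Qed.


(** Every later entry is either counted or falls within an interrupting write; both kinds are finite
    in number, and so the entry times are bounded. *)
Lemma entries_bounded i e0 : 1 < n -> (forall t, waits_until i e0 t) ->
  exists T, e0 <= T /\ forall j t, T <= t -> ~ enters j t.
Proof.
move=> n1 wi.
have [sc _ inc] := @at_most_counted i e0 n1.
have [si _ ini] := @at_most_interrupting i e0.
have [m1 b1] := all_leq_bound [seq x.2 | x <- sc].
have [m2 b2] := all_leq_bound [seq x.2 | x <- si].
exists (e0 + m1 + m2).+1; split; first by lia.
move=> j t lt jt; have e0t : e0 < t by lia.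
have [[w [iw wt]]|no] := classic (exists w : nat * nat,
    interrupting i e0 w /\ w.1 <= t <= w.2).
  by have := b2 w.2 (map_f snd (ini w iw)); lia.
have ji : j <> i.
  by move=> ji; case: jt; have := wi t.+1 t.+1 ltac:(lia); rewrite ji;
  move=> + _ H; rewrite H.
suff c : counted i e0 (j, t) by have := b1 t (map_f snd (inc _ c)); lia.
apply: entry_counted_or_interrupted => // w iw wt; apply: no; exists w; split=> //.
Qed.

Definition locking p :=
  match p with W1 | R1 _ | R2 _ _ => true | _ => false end.

Lemma reaches_R1 T j t : (forall t b, T <= t -> cp t j <> DL b) -> T <= t ->
  locking (cp t j) -> exists2 u, t <= u & cp u j = R1 false.
Proof.
move=> noDL.
pose rank p := match p : pc n with
  | W1 => 4 | R1 b => if b then 3 else 0 | R2 b _ => if b then 1 else 2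
  | _ => 0 end.
elim/ltn_ind: {t}(rank _) {-2}t (erefl (rank (cp t j))) => r IH t Er Tt lt.
have [|s [a [ts _ tr _ _]]] := @next_event t j; first by case: (cp t j) lt.
have [E|nE] := classic (cp t j = R1 false); first by exists t.
have H : rank (cp s.+1 j) < r /\ locking (cp s.+1 j).
  have noDL' b : cp s.+1 j <> DL b by apply: noDL; lia.
  rewrite -Er; move: lt tr nE noDL'; case: (cp t j) => //= [|[]|[] ?] _ tr;
  by inversion tr => // _ /(_ false).
have [u su Eu] := IH _ (proj1 H) s.+1 erefl ltac:(lia) (proj2 H).
by exists u => //; lia.
Qed.

(** An iteration started after [T] would read k in R1 and then succeed in its test, either because k
    = j or because FLAG[k] reads 0, leading to the excluded DLF.lock. *)
Lemma passes_loop T j k u : (forall t b, T <= t -> cp t j <> DL b) ->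
  (forall t, T <= t -> tv t = k) ->
  (forall t q x, T <= t -> cp t q <> W3 true x) ->
  j = k \/ (forall t, T <= t -> down (cp t k)) ->
  T <= u -> cp u j <> R1 false.
Proof.
move=> noDL tk noW jk Tu Eu.
have [|s1 [a1 [us1 Es1 tr1 ct1 _]]] := @next_event u j; first by rewrite Eu.
rewrite Eu in tr1 ct1.
have E1 : cp s1.+1 j = R1 true by inversion tr1.
have [|s2 [a2 [us2 Es2 tr2 ct2 _]]] := @next_event s1.+1 j; first by rewrite E1.
rewrite E1 in tr2 ct2.
have [x [E2 Ea2]] : exists x, cp s2.+1 j = R2 false x /\ a2 = TurnRE x.
  by inversion tr2; exists k0.
subst a2; have xk : x = k.
  have [|||s [us -> _]] := turn_clean Es2 (u := s1); first by lia.
  - by rewrite ct1 ?ct2 //; lia.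
  - by move=> w q y H _; apply: noW; lia.
  by apply: tk; lia.
subst x.
have [|s3 [a3 [us3 Es3 tr3 ct3 _]]] := @next_event s2.+1 j; first by rewrite E2.
rewrite E2 in tr3 ct3.
have {tr3} [E3 jk'] : cp s3.+1 j = R2 true k /\ k <> j.
  by inversion tr3 => //; subst; case: (noDL s3.+1 false); [lia|].
have {}jk : forall t, T <= t -> down (cp t k) by case: jk => // /esym.
have [|s4 [a4 [us4 Es4 tr4 ct4 _]]] := @next_event s3.+1 j; first by rewrite E3.
rewrite E3 in tr4 ct4.
have Ea4 : a4 = FlagRE k true.
  by inversion tr4 => //; subst; case: (noDL s4.+1 false); [lia|].
subst a4; suff: true = false by [].
apply: (flag_down_clean Es4 (u := s3)); first by lia.
  by rewrite ct3 ?ct4 //; lia.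
by move=> w H _; apply: jk; lia.
Qed.

Lemma waiting_ends i e0 : 1 < n -> ~ (forall t, waits_until i e0 t).
Proof.
move=> n1 wi; have [T [e0T noE]] := entries_bounded n1 wi.
have noDL t j b : T <= t -> cp t j <> DL b.
  have noDL1 t' : T <= t' -> cp t' j <> DL true.
    by move=> Tt /dlf[u tu [k]]; apply: noE; lia.
  move=> Tt; case: b; first exact: noDL1.
  move=> E; have [|s [a [ts _ tr ct _]]] := @next_event t j; first by rewrite E.
  rewrite E in tr; inversion tr; subst; first by case: (noDL1 s.+1) => //; lia.
  by apply: (noE j s); [lia|split=> //; rewrite ct ?E // ts leqnn].
have [T' [TT' nd]] : exists T', T <= T' /\ forall t q, T' <= t -> ~~ dcrit (cp t q).
  have [[q dq]|no] := classic (exists q, dcrit (cp T q)).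
    have [T' TT' nq] := leaves_dcrit q T.
    exists T'; split=> // t q' Tt; have [->|/eqP qq] := eqVneq q' q.
      exact: (enters_preserve_ndcrit noE TT' Tt nq).
    apply: (enters_preserve_ndcrit noE (u := T)) => //; first by lia.
    by apply/negP => dq'; apply: qq; apply: mutex dq.
  exists T; split=> // t q Tt; apply: (enters_preserve_ndcrit noE (u := T)) => //.
  by apply/negP => dq; apply: no; exists q.
have noW t q x : T' <= t -> cp t q <> W3 true x.
  by move=> Tt E; have := nd t q Tt; rewrite E.
have tk t : T' <= t -> tv t = tv T'.
  by move=> Tt; apply: tv_const => // w q x H; apply: noW; lia.
(* From [T'] on TURN has a constant value k. Applied to p_k, this shows that p_k never locks again,
   so FLAG[k] stays down; applied to p_i, it then contradicts the endless wait. *)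
have stuck j t : T' <= t -> locking (cp t j) ->
    ~ (j = tv T' \/ forall t, T' <= t -> down (cp t (tv T'))).
  move=> Tt lt H.
  have noDL' u b : T' <= u -> cp u j <> DL b by move=> ?; apply: noDL; lia.
  have [u tu Eu] := reaches_R1 noDL' Tt lt.
  by apply: (passes_loop noDL' tk noW H _ Eu); lia.
apply: (stuck i T'.+1) => //.
  have := wi T'.+1 T'.+1 ltac:(lia); have := noDL T'.+1 i.
  by case: (cp _ i) => //= b /(_ b) H; case: H => //; lia.
right=> t Tt; have := stuck (tv T') t Tt; have := nd t (tv T') Tt.
have := @noDL t (tv T').
case: (cp t _) => //= [|?|? ?|b H]; last by case: (H b) => //; lia.
all: by move=> _ _ H; case: (H isT); left.
Qed.

End Model.

(** * Projection of runs of Algorithm B to runs of DLF *)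

Section StepInversion.
Variables (n : nat) (P : protocol n) (i : 'I_n).
Implicit Types (c : pconf P) (a : event P).

(** An invocation has no event of its own. This is the configuration from which the first
    instruction of the invoked function is executed. *)
Definition entered c : pconf P :=
  match c with
  | PConf Remainder l false => PConf Locking (lock_entry i l) false
  | PConf Critical l false => PConf Unlocking (unlock_entry i l) false
  | _ => c
  end.

(** The relation [pstep] by cases on the current instruction, so that steps of [codeB] are obtained
    by computation. *)
Definition step_from c a c' : Prop :=
  match code i (loc c), busy c with
  | Read r k, false => a = Defs.Mem (RStart r) /\ c' = PConf (ph c) (loc c) true
  | Read r k, true =>
      exists v, a = Defs.Mem (REnd r v) /\ c' = PConf (ph c) (k v) false
  | Write r v l, false =>
      a = Defs.Mem (WStart r v) /\ c' = PConf (ph c) (loc c) true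
  | Write r v l, true => a = Defs.Mem (WEnd r) /\ c' = PConf (ph c) l false
  | Local l, false => a = Step P /\ c' = PConf (ph c) l false
  | Return, false => a = Ret P /\
      c' = PConf (if ph c is Locking then Critical else Remainder) (loc c) false
  | _, true => False
  end.

Lemma pstepP c a c' : pstep i c a c' -> step_from (entered c) a c'.
Proof.
have en f l : f = Locking \/ f = Unlocking ->
    entered (PConf f l false) = PConf f l false by case=> ->.
have eb f l : entered (PConf f l true) = PConf f l true by case: f.
elim=> {c a c'} //.
- by move=> f l r k /en -> E; rewrite /step_from /= E.
- by move=> f l r k v E; rewrite eb /step_from /= E; exists v.
- by move=> f l r v l' /en -> E; rewrite /step_from /= E.
- by move=> f l r v l' E; rewrite eb /step_from /= E.
- by move=> f l l' /en -> E; rewrite /step_from /= E.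
- by move=> l E; rewrite /step_from /= E.
- by move=> l E; rewrite /step_from /= E.
Qed.

Lemma step_fromW c a c' :
  ph (entered c) = Locking \/ ph (entered c) = Unlocking ->
  step_from (entered c) a c' -> pstep i c a c'.
Proof.
have busyless f l b : f = Locking \/ f = Unlocking ->
    step_from (PConf f l b) a c' -> pstep i (PConf f l b) a c'.
  rewrite /step_from /= => fl.
  case E: (code i l) => [r k|r v l'|l'|]; case: b => //.
  - by case=> v [-> ->]; apply: step_rend.
  - by case=> -> ->; apply: step_rstart E.
  - by case=> -> ->; apply: step_wend E.
  - by case=> -> ->; apply: step_wstart E.
  - by case=> -> ->; apply: step_local.
  - case=> -> ->; case: fl => ->; [exact: step_ret_lock|exact: step_ret_unlock].
case: c => -[] l [] /= fl; try by case: fl.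
- by move/(busyless _ _ _ fl); apply: step_lock.
- exact: busyless.
- exact: busyless.
- by move/(busyless _ _ _ fl); apply: step_unlock.
- exact: busyless.
- exact: busyless.
Qed.

End StepInversion.

Section Simulation.
Variables (n : nat) (D : protocol n) (turn0 : 'I_n).
Let B := algorithmB D turn0.
Implicit Types (c : pconf B) (d : pconf D) (p : pc n) (a : event B).

Definition act_of a : act n :=
  match a with
  | Defs.Mem (RStart (FLAG k)) => FlagRS k
  | Defs.Mem (RStart (TURN)) => TurnRS
  | Defs.Mem (REnd r v) =>
      match r return domB r -> act n with
      | FLAG k => fun b => FlagRE k b
      | TURN => fun k => TurnRE k
      | Own _ => fun _ => Other
      end v
  | Defs.Mem (WStart r v) =>
      match r return domB r -> act n with
      | FLAG k => fun b => FlagWS k b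
      | TURN => fun k => TurnWS k
      | Own _ => fun _ => Other
      end v
  | Defs.Mem (WEnd (FLAG k)) => FlagWE k
  | Defs.Mem (WEnd (TURN)) => TurnWE
  | _ => Other
  end.

Definition in_dlf (x : lineB n) : bool :=
  match x with DLFLock | DLFUnlock => true | _ => false end.

(** A local step belongs to DLF only on its own lines; the other one is the exit from the loop by
    the test tmp = i. Every return is DLF's, since Algorithm B returns only on these lines. *)
Definition dlf_event (x : lineB n) a : option (event D) :=
  match a with
  | Defs.Mem m => omap (@Defs.Mem n D) (own_event m)
  | Step => if in_dlf x then Some (Step D) else None
  | Ret => Some (Ret D)
  end.

(* A process in DL false or DU false has not yet started the DLF function:    *)
(* its DLF configuration is still the one preceding the call.                 *)
Inductive link (i : 'I_n) : pconf B -> pconf D -> pc n -> Prop :=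
| LRem x l : link i (@PConf n B Remainder (x, l) false)
    (PConf Remainder l false) Rem
| LW1 l : link i (@PConf n B Locking (SetFlag n, l) true)
    (PConf Remainder l false) W1
| LR1 l b : link i (@PConf n B Locking (ReadTurn n, l) b)
    (PConf Remainder l false) (R1 b)
| LR2 l k b : link i (@PConf n B Locking (TestFlag k, l) b)
    (PConf Remainder l false) (R2 b k)
| LDL0 l : link i (@PConf n B Locking (DLFLock n, lock_entry i l) false)
    (PConf Remainder l false) (DL false)
| LDL1 l b : link i (@PConf n B Locking (DLFLock n, l) b)
    (PConf Locking l b) (DL true)
| LCs l : link i (@PConf n B Critical (DLFLock n, l) false)
    (PConf Critical l false) Cs
| LW2 l : link i (@PConf n B Unlocking (ResetFlag n, l) true)
    (PConf Critical l false) W2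
| LR3 l b : link i (@PConf n B Unlocking (ReadTurn' n, l) b)
    (PConf Critical l false) (R3 b)
| LR4 l k b : link i (@PConf n B Unlocking (TestFlag' k, l) b)
    (PConf Critical l false) (R4 b k)
| LW3 l k b : link i (@PConf n B Unlocking (SetTurn k, l) b)
    (PConf Critical l false) (W3 b k)
| LDU0 l : link i (@PConf n B Unlocking (DLFUnlock n, unlock_entry i l) false)
    (PConf Critical l false) (DU false)
| LDU1 l b : link i (@PConf n B Unlocking (DLFUnlock n, l) b)
    (PConf Unlocking l b) (DU true).

Lemma dlf_step i f (x : lineB n) l b a c' : in_dlf x ->
  @step_from n B i (@PConf n B f (x, l) b) a c' ->
  exists (a' : event D) l', [/\ dlf_event x a = Some a', act_of a = Other &
    (exists b', c' = @PConf n B f (x, l') b' /\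
      step_from i (PConf f l b) a' (PConf f l' b')) \/
    c' = @PConf n B (if f is Locking then Critical else Remainder) (x, l') false /\
      step_from i (PConf f l b) a'
        (PConf (if f is Locking then Critical else Remainder) l' false)].
Proof.
rewrite /step_from /= => dx.
have -> : codeB i (x, l) = dlf_instr x (code i l) by case: x dx.
case: (code i l) => [r k|r v l'|l'|] /=; case: b => //.
- case=> v [-> ->]; exists (Defs.Mem (REnd r v)), (k v); split=> //.
  by left; exists false; split=> //; exists v.
- case=> -> ->; exists (Defs.Mem (RStart r)), l; split=> //.
  by left; exists true.
- case=> -> ->; exists (Defs.Mem (WEnd r)), l'; split=> //.
  by left; exists false.
- case=> -> ->; exists (Defs.Mem (WStart r v)), l; split=> //.
  by left; exists true.
- case=> -> ->; exists (Step D), l'; split=> //; first by rewrite /= dx.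
  by left; exists false.
- case=> -> ->; exists (Ret D), l; split=> //.
  by right.
Qed.

Lemma simulation i c d p a c' : link i c d p -> pstep i c a c' ->
  exists d' p', [/\ link i c' d' p', trans i p (act_of a) p' &
    if dlf_event (loc c).1 a is Some a' then pstep i d a' d' else d' = d].
Proof.
move=> L /pstepP; case: L => {c d p}.
- move=> x l; rewrite /step_from /= => -[-> ->].
  by exists (PConf Remainder l false), W1; split=> //; constructor.
- move=> l; rewrite /step_from /= => -[-> ->].
  by exists (PConf Remainder l false), (R1 false); split=> //; constructor.
- move=> l []; rewrite /step_from /=.
    case=> v [-> ->].
    by exists (PConf Remainder l false), (R2 false v); split=> //; constructor.
  case=> -> ->.
  by exists (PConf Remainder l false), (R1 true); split=> //; constructor.
- move=> l k b; have [->|ki] := eqVneq k i.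
    rewrite /step_from /= /codeB /= eqxx.
    case: b => // -[-> ->].
    by exists (PConf Remainder l false), (DL false); split=> //; constructor.
  rewrite /step_from /= /codeB /= (negbTE ki).
  case: b.
    case=> -[] [-> ->].
      by exists (PConf Remainder l false), (R1 false); split=> //; constructor.
    by exists (PConf Remainder l false), (DL false); split=> //; constructor.
  case=> -> ->.
  exists (PConf Remainder l false), (R2 true k); split=> //; constructor.
  exact/eqP.
- move=> l S; have {S} [] := dlf_step _ S => // a' [l' [Ea Eo]].
  rewrite Eo /= Ea => -[[b' [-> S]]|[-> S]].
    exists (PConf Locking l' b'), (DL true); split=> //; try by constructor.
    by apply: step_fromW => //; left.
  exists (PConf Critical l' false), Cs; split=> //; try by constructor.
  by apply: step_fromW => //; left.
- move=> l b S.
  have [] := @dlf_step i Locking (DLFLock n) l b a c' isT.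
    by case: b S => S; exact: S.
  move=> {S} a' [l' [Ea Eo]].
  rewrite Eo /= Ea => -[[b' [-> S]]|[-> S]].
    exists (PConf Locking l' b'), (DL true); split=> //; try by constructor.
    by case: b S => S; apply: step_fromW => //; left.
  exists (PConf Critical l' false), Cs; split=> //; try by constructor.
  by case: b S => S; apply: step_fromW => //; left.
- move=> l; rewrite /step_from /= => -[-> ->].
  by exists (PConf Critical l false), W2; split=> //; constructor.
- move=> l; rewrite /step_from /= => -[-> ->].
  by exists (PConf Critical l false), (R3 false); split=> //; constructor.
- move=> l []; rewrite /step_from /=.
    case=> v [-> ->].
    by exists (PConf Critical l false), (R4 false v); split=> //; constructor.
  case=> -> ->.
  by exists (PConf Critical l false), (R3 true); split=> //; constructor.
- move=> l k []; rewrite /step_from /=.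
    case=> -[] [-> ->].
      by exists (PConf Critical l false), (DU false); split=> //; constructor.
    by exists (PConf Critical l false), (W3 false k); split=> //; constructor.
  case=> -> ->.
  by exists (PConf Critical l false), (R4 true k); split=> //; constructor.
- move=> l k []; rewrite /step_from /= => -[-> ->].
    by exists (PConf Critical l false), (DU false); split=> //; constructor.
  by exists (PConf Critical l false), (W3 true k); split=> //; constructor.
- move=> l S; have {S} [] := dlf_step _ S => // a' [l' [Ea Eo]].
  rewrite Eo /= Ea => -[[b' [-> S]]|[-> S]].
    exists (PConf Unlocking l' b'), (DU true); split=> //; try by constructor.
    by apply: step_fromW => //; right.
  exists (PConf Remainder l' false), Rem; split=> //; try by constructor.
  by apply: step_fromW => //; right.
- move=> l b S.
  have [] := @dlf_step i Unlocking (DLFUnlock n) l b a c' isT.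
    by case: b S => S; exact: S.
  move=> {S} a' [l' [Ea Eo]].
  rewrite Eo /= Ea => -[[b' [-> S]]|[-> S]].
    exists (PConf Unlocking l' b'), (DU true); split=> //; try by constructor.
    by case: b S => S; apply: step_fromW => //; right.
  exists (PConf Remainder l' false), Rem; split=> //; try by constructor.
  by case: b S => S; apply: step_fromW => //; right.
Qed.

Lemma link_phase i c d p : link i c d p ->
  [/\ p = Rem <-> ph c = Remainder, p = Cs <-> ph c = Critical,
      p = DL true <-> ph d = Locking, p = DU true <-> ph d = Unlocking
    & dcrit p <-> ph d = Critical].
Proof. by case=> //=; split=> //; case. Qed.

Lemma link_dlf_event i c d p a c' : link i c d p ->
  p = DL true \/ p = DU true -> pstep i c a c' ->
  exists a' : event D, dlf_event (loc c).1 a = Some a'.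
Proof.
move=> L dl /pstepP.
case: L dl => {c d p}; try by (intros; intuition discriminate).
- move=> l b _ S; have [] := @dlf_step i Locking (DLFLock n) l b a c' isT.
    by case: b S => S; exact: S.
  by move=> a' [l' [Ea _ _]]; exists a'.
- move=> l b _ S; have [] := @dlf_step i Unlocking (DLFUnlock n) l b a c' isT.
    by case: b S => S; exact: S.
  by move=> a' [l' [Ea _ _]]; exists a'.
Qed.

End Simulation.

(** * The DLF run inside a run of Algorithm B *)

Section Execution.
Variables (n : nat) (D : protocol n) (turn0 : 'I_n).
Let B := algorithmB D turn0.
Hypotheses (mutD : mutual_exclusion D) (dlfD : deadlock_free D).
Variables (tr : trace B) (cf : confs B).
Hypothesis runB : run tr cf.

Definition acts t : option ('I_n * act n) :=
  if tr t is Some (i, a) then Some (i, act_of a) else None.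

Definition dlf_trace : trace D := fun t =>
  if tr t is Some (i, a) then omap (pair i) (dlf_event (loc (cf t i)).1 a)
  else None.

Let h := history tr.

Lemma simulated : exists (df : confs D) (cp : nat -> 'I_n -> pc n),
  [/\ forall i, df 0 i = PConf Remainder (linit D i) false,
      forall t i, link i (cf t i) (df t i) (cp t i) &
      forall t, match tr t with
        | Some (i, a) => [/\ trans i (cp t i) (act_of a) (cp t.+1 i),
            forall j, j <> i -> df t.+1 j = df t j /\ cp t.+1 j = cp t j &
            if dlf_event (loc (cf t i)).1 a is Some a'
            then pstep i (df t i) a' (df t.+1 i) else df t.+1 i = df t i]
        | None => forall j, df t.+1 j = df t j /\ cp t.+1 j = cp t j
        end].
Proof.
have [cf0 step _ _] := runB.
pose I t (s : 'I_n -> pconf D * pc n) :=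
  forall i, link i (cf t i) (s i).1 (s i).2.
pose R t (s s' : 'I_n -> pconf D * pc n) :=
  match tr t with
  | Some (i, a) => [/\ trans i (s i).2 (act_of a) (s' i).2,
      forall j, j <> i -> s' j = s j &
      if dlf_event (loc (cf t i)).1 a is Some a'
      then pstep i (s i).1 a' (s' i).1 else (s' i).1 = (s i).1]
  | None => forall j, s' j = s j
  end.
have [|t s It|f [f0 fIR]] := @invariant_choice _ I R
  (fun i => (PConf Remainder (linit D i) false, Rem)).
- by move=> i; rewrite cf0; constructor.
- move: (step t); rewrite /R; case: (tr t) => [[i a]|] /= st; last first.
    by exists s; split=> // i; rewrite st; apply: It.
  have [ps ot] := st; have [d' [p' [L' T' S']]] := simulation (It i) ps.
  exists (fun j => if j == i then (d', p') else s j); split.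
    move=> j; case: eqVneq => [->//|/eqP ji]; rewrite ot //; exact: It.
  by rewrite eqxx; split=> // j /eqP/negbTE ->.
exists (fun t i => (f t i).1), (fun t i => (f t i).2); split.
- by move=> i; rewrite f0.
- by move=> t i; have [It _] := fIR t; apply: It.
- move=> t; have [_] := fIR t; rewrite /R.
  case: (tr t) => [[i a]|] //= => [[T O S]|O]; last by move=> j; rewrite O.
  by split=> // j ji; rewrite O.
Qed.

Section Simulated.
Variables (df : confs D) (cp : nat -> 'I_n -> pc n).
Hypothesis df0 : forall i, df 0 i = PConf Remainder (linit D i) false.
Hypothesis linked : forall t i, link i (cf t i) (df t i) (cp t i).
Hypothesis sim_step : forall t, match tr t with
  | Some (i, a) => [/\ trans i (cp t i) (act_of a) (cp t.+1 i),
      forall j, j <> i -> df t.+1 j = df t j /\ cp t.+1 j = cp t j &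
      if dlf_event (loc (cf t i)).1 a is Some a'
      then pstep i (df t i) a' (df t.+1 i) else df t.+1 i = df t i]
  | None => forall j, df t.+1 j = df t j /\ cp t.+1 j = cp t j
  end.

Lemma cp_init j : cp 0 j = Rem.
Proof.
have [cf0 _ _ _] := runB; have [[_ H] _ _ _ _] := link_phase (linked 0 j).
by apply: H; rewrite cf0.
Qed.

Lemma cp_steps t :
  match acts t with
  | Some (j, a) => trans j (cp t j) a (cp t.+1 j) /\
                   forall j', j' <> j -> cp t.+1 j' = cp t j'
  | None => forall j, cp t.+1 j = cp t j
  end.
Proof.
rewrite /acts; move: (sim_step t); case: (tr t) => [[i a]|] /=.
  by case=> T O _; split=> // j /O[].
by move=> O j; case: (O j).
Qed.

Lemma cp_fair j t : cp t j <> Rem ->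
  exists2 t', t <= t' & exists a, acts t' = Some (j, a).
Proof.
have [_ _ _ fair] := runB; have [[H _] _ _ _ _] := link_phase (linked t j).
have [[_ H'] _ _ _ _] := link_phase (linked t j).
move=> nR; have [t' tt' [a Ea]] := fair j t (fun E => nR (H' E)).
by exists t' => //; exists (act_of a); rewrite /acts Ea.
Qed.

Lemma own_history_trace : history dlf_trace = own_history h.
Proof.
apply: functional_extensionality => t.
rewrite /history /dlf_trace /own_history /h /history.
case: (tr t) => [[i [m||]]|] //=; first by case: (own_event m).
by case: (in_dlf _).
Qed.

Lemma dlf_fair i t : ph (df t i) <> Remainder ->
  exists2 t', t <= t' & exists a, dlf_trace t' = Some (i, a).
Proof.
(* A pending DLF function moves at the next event of the process, and a DLF   *)
(* critical section lasts for a bounded number of events of lines 11-14.      *)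
have pending t' : cp t' i = DL true \/ cp t' i = DU true ->
    exists2 t'', t' <= t'' & exists a, dlf_trace t'' = Some (i, a).
  move=> dl; have [|s [a [ts Es _ cs _]]] := @next_event _ _ _ cp_steps cp_fair t' i.
    by case: dl => ->.
  exists s => //; rewrite -(cs s) ?ts ?leqnn // in dl.
  have [_ step _ _] := runB; move: Es (step s); rewrite /acts /dlf_trace.
  case: (tr s) => [[j b]|] // [-> _] [ps _].
  by have [a' ->] := link_dlf_event (linked s i) dl ps; exists a'.
have [_ _ [_ lk] [_ ul] [_ cr]] := link_phase (linked t i).
case E: (ph (df t i)) => // _; [by apply: pending; left; auto| |
  by apply: pending; right; auto].
have dt : dcrit (cp t i) by auto.
have [u0 tu0 nu0] := leaves_dcrit cp_steps cp_fair i t.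
have [u [/andP[tu _] nu minu]] :=
  @least_witness (fun u => ~~ dcrit (cp u i)) _ _ tu0 nu0.
case: u => [|u] in tu nu minu *; first by case/negP: nu; have <- : t = 0 by lia.
have tu' : t <= u.
  by have [E'|] := eqVneq t u.+1; [rewrite -E' dt in nu|lia].
have du : dcrit (cp u i) by apply/negPn/negP/minu; lia.
exists u => //; rewrite /dlf_trace; move: (sim_step u).
case Eu: (tr u) => [[j b]|]; last by move=> /(_ i)[_ H]; rewrite H du in nu.
have [->|/eqP ij] := eqVneq j i; last first.
  by case=> _ /(_ i (nesym ij))[_ H]; rewrite H du in nu.
case=> _ _; case: (dlf_event _ _) => [b' _|H] /=; first by exists b'.
have [_ _ _ _ [_ cr']] := link_phase (linked u.+1 i).
have [_ _ _ _ [cr'' _]] := link_phase (linked u i).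
by rewrite cr' // H cr'' in nu.
Qed.

Lemma dlf_run : run dlf_trace df.
Proof.
have [_ _ [_ _ mem] _] := runB.
split=> //; [|by rewrite own_history_trace|exact: dlf_fair].
move=> t; move: (sim_step t); rewrite /dlf_trace.
case: (tr t) => [[i a]|]; last by move=> H j; case: (H j).
case=> _ O; case: (dlf_event _ _) => [a'|] /= S.
  by split=> // j /O[].
move=> j; have [->//|/eqP ji] := eqVneq j i; by case: (O j ji).
Qed.

Lemma cp_mutex t j k : dcrit (cp t j) -> dcrit (cp t k) -> j = k.
Proof.
have [_ _ _ _ [cj _]] := link_phase (linked t j).
have [_ _ _ _ [ck _]] := link_phase (linked t k).
by move=> /cj dj /ck dk; apply: (mutD dlf_run dj dk).
Qed.

(** The only transition into [dcrit] is the one from DLF.lock to [Cs], so the end of a DLF.lock is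
    also an entry for Algorithm B. *)
Lemma cp_dlf t j : cp t j = DL true ->
  exists2 t', t <= t' & exists k, enters cp k t'.
Proof.
have [_ _ [lj _] _ _] := link_phase (linked t j).
move=> /lj /(dlfD dlf_run)[t' tt' [k [nc c]]]; exists t' => //; exists k.
have [_ _ _ _ [d1 _]] := link_phase (linked t' k).
have [_ _ _ _ [_ d2]] := link_phase (linked t'.+1 k).
have nd : ~~ dcrit (cp t' k) by apply/negP => /d1.
have := d2 c; rewrite /enters.
have [[-> _]|[a _]] := cpP cp_steps t' k; first by rewrite (negbTE nd).
by move=> T; case: T nd => //=.
Qed.

(** * Safe registers *)

Definition mem_of_act (a : act n) : option (mem_event (@domB n D)) :=
  match a with
  | FlagWS k b => Some (@WStart _ (@domB n D) (FLAG D k) b)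
  | FlagWE k => Some (WEnd (FLAG D k))
  | FlagRS k => Some (RStart (FLAG D k))
  | FlagRE k b => Some (@REnd _ (@domB n D) (FLAG D k) b)
  | TurnWS k => Some (@WStart _ (@domB n D) (TURN D) k)
  | TurnWE => Some (WEnd (TURN D))
  | TurnRS => Some (RStart (TURN D))
  | TurnRE k => Some (@REnd _ (@domB n D) (TURN D) k)
  | Other => None
  end.

Lemma history_of_acts t j a m : acts t = Some (j, a) -> mem_of_act a = Some m ->
  h t = Some (j, m).
Proof.
rewrite /acts /h /history; case: (tr t) => [[i b]|] // [-> <-].
by case: b => // -[[]|[]|[]|[]] //= > [<-].
Qed.

Lemma acts_of_history t j m : h t = Some (j, m) ->
  acts t = Some (j, @act_of n D turn0 (Defs.Mem m)).
Proof.
by rewrite /h /history /acts; case: (tr t) => [[i [m'||]]|] // [-> ->].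
Qed.

Lemma silent_of_quiet j s e : quiet acts j s e -> silent h j s e.
Proof. by move=> q u m su /acts_of_history; apply: q. Qed.

Lemma is_write_disjoint p (r r' : regB D) (v : domB r) (v' : domB r')
    s e s' e' :
  is_write h p v s e -> is_write h p v' s' e' -> s' <> s ->
  ~ overlap (s, e) (s', e').
Proof.
have half (x x' : regB D) (y : domB x) (y' : domB x') a b a' b' :
    is_write h p y a b -> is_write h p y' a' b' -> a < a' -> ~ a' <= b.
  move=> [_ _ Eb si] [_ Ea' _ _] aa; rewrite leq_eqVlt => /orP[/eqP E|lt].
    by rewrite -E Ea' in Eb.
  by apply: (si a' _ _ Ea'); lia.
rewrite /overlap /= => w w' ss /andP[a b].
have [lt|lt|E] := ltngtP s s'; last by case: ss.
  exact: half w w' lt b.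
exact: half w' w lt a.
Qed.

Lemma overlap_common s e s' e' : s < e -> s' < e' -> s <> e' -> s' <> e ->
  overlap (s, e) (s', e') -> exists2 u, s < u <= e & s' < u <= e'.
Proof.
rewrite /overlap /= => se se' ne ne' ov.
by exists (maxn s s').+1; lia.
Qed.

Definition writing_flag (p : pc n) :=
  match p with W1 | W2 => true | _ => false end.

Lemma flag_write_busy p k (v : bool) s e :
  is_write h p (v : @domB n D (FLAG D k)) s e ->
  p = k /\ forall u, s < u <= e -> cp u k = if v then W1 else W2.
Proof.
move=> [se Es Ee si]; have As := acts_of_history Es.
have T := cp_trans cp_steps As; rewrite /= in T.
have [pk E1] : p = k /\ cp s.+1 k = if v then W1 else W2 by inversion T; subst.
subst k; split=> //; elim=> // u IH su.
have [<-//|su'] := eqVneq s u.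
have {IH} := IH ltac:(lia).
have [[-> _]//|[a Ea Ta]] := cpP cp_steps u p.
move=> E; rewrite E in Ta; exfalso.
have Ef : a = FlagWE p by case: (v) Ta => Ta; inversion Ta.
subst a; apply: (si u _ _ (history_of_acts Ea erefl)); lia.
Qed.

Lemma turn_write_busy p (v : 'I_n) s e :
  is_write h p (v : @domB n D (TURN D)) s e ->
  exists x, v = ordS x /\ forall u, s < u <= e -> cp u p = W3 true x.
Proof.
move=> [se Es Ee si]; have As := acts_of_history Es.
have T := cp_trans cp_steps As; rewrite /= in T.
have [x [vx E1]] : exists x, v = ordS x /\ cp s.+1 p = W3 true x.
  by inversion T; exists k.
exists x; split=> //; elim=> // u IH su.
have [<-//|su'] := eqVneq s u.
have {IH} := IH ltac:(lia).
have [[-> _]//|[a Ea Ta]] := cpP cp_steps u p.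
move=> E; rewrite E in Ta; exfalso.
have Ef : a = TurnWE by inversion Ta.
subst a; apply: (si u _ _ (history_of_acts Ea erefl)); lia.
Qed.

Lemma flag_content k (content : nat -> bool) :
  content 0 = false ->
  (forall t, (forall p (v : bool) s e,
      is_write h p (v : @domB n D (FLAG D k)) s e -> ~ (s <= t <= e)) ->
    content t.+1 = content t) ->
  (forall p (v : bool) s e, is_write h p (v : @domB n D (FLAG D k)) s e ->
    (forall p' (v' : bool) s' e',
       is_write h p' (v' : @domB n D (FLAG D k)) s' e' -> s' <> s ->
       ~ overlap (s, e) (s', e')) ->
    content e.+1 = v) ->
  forall t, (up (cp t k) -> content t = true) /\
            (down (cp t k) -> content t = false).
Proof.
move=> c0 idle written; elim=> [|t [IHu IHd]]; first by rewrite cp_init c0.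
have [wf|nwf] := boolP (writing_flag (cp t k)).
  have [[-> _]|[a Ea T]] := cpP cp_steps t k; first by case: (cp t k) wf.
  have [|s [b [st Es qs Ts cs]]] := @last_event _ _ _ cp_init cp_steps t k.
    by case: (cp t k) wf.
  have W (v : bool) : b = FlagWS k v -> content t.+1 = v.
    move=> Eb; subst b; apply: (written k v s t).
      split=> //; first exact: (history_of_acts Es erefl).
        suff Ea' : a = FlagWE k by subst a; exact: (history_of_acts Ea erefl).
        by case: (cp t k) wf T => // _ T; inversion T.
      exact: silent_of_quiet.
    move=> p' v' s' e' w' ss; have [pk _] := flag_write_busy w'; subst p'.
    apply: is_write_disjoint w' ss.
    split=> //; first exact: (history_of_acts Es erefl).
      suff Ea' : a = FlagWE k by subst a; exact: (history_of_acts Ea erefl).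
      by case: (cp t k) wf T => // _ T; inversion T.
    exact: silent_of_quiet.
  case: (cp t k) wf T Ts => // _ T Ts; inversion T; inversion Ts; subst;
    by split=> // _; apply: W.
have [wf'|nwf'] := boolP (writing_flag (cp t.+1 k)).
  by case: (cp t.+1 k) wf'.
have cE : content t.+1 = content t.
  apply: idle => p v s e w se; have [_ wb] := flag_write_busy w.
  have [E|st] := eqVneq s t.
    by move: nwf'; rewrite wb; [case: (v)|case: w => ? _ _ _; lia].
  by move: nwf; rewrite wb; [case: (v)|lia].
rewrite cE; have [[-> _]//|[a _ T]] := cpP cp_steps t k.
case: T nwf nwf' IHu IHd => //= *; split=> //; auto.
Qed.

Lemma flag_safe k : @safe_register n _ (@domB n D) h (FLAG D k) false.
Proof. by have [_ _ [H _ _] _] := runB; apply: H. Qed.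

Lemma flag_read j k b s e : s < e -> acts s = Some (j, FlagRS k) ->
  acts e = Some (j, FlagRE k b) -> quiet acts j s e ->
  (forall u, s < u <= e -> ~~ writing_flag (cp u k)) ->
  (up (cp s.+1 k) -> b = true) /\ (down (cp s.+1 k) -> b = false).
Proof.
move=> se Es Ee qs nw; have [content [c0 idle written read]] := flag_safe k.
have [cu cd] := flag_content c0 idle written s.
have -> : b = content s.
  apply: (read j b s e) => [|p v s' e' w ov].
    split=> //; first exact: (history_of_acts Es erefl).
      exact: (history_of_acts Ee erefl).
    exact: silent_of_quiet.
  have [_ wb] := flag_write_busy w; case: (w) => se' Es' Ee' _.
  have [||u us us'] := overlap_common se se' _ _ ov.
  - move=> E; have := history_of_acts Es erefl.
    by rewrite E Ee'.
  - move=> E; have := history_of_acts Ee erefl.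
    by rewrite -E Es'.
  by have := nw u us; rewrite wb //; case: (v).
have [[-> _]//|[a Ea T]] := cpP cp_steps s k.
have nws := nw s.+1 ltac:(lia).
have [kj|kj] := eqVneq k j.
  have Ea' : a = FlagRS k by move: Ea; rewrite {1}kj Es => -[].
  have [E E'] : cp s k = R4 false k /\ cp s.+1 k = R4 true k.
    by rewrite Ea' in T; inversion T.
  by rewrite E' /=; split=> // _; apply: cd; rewrite E.
by move: (cp_steps s); rewrite Es => -[_ O]; rewrite (O k (elimN eqP kj)).
Qed.

Fixpoint turn_value t : 'I_n :=
  if t is t.+1 then
    if acts t is Some (j, TurnWE) then
      if cp t j is W3 true k then ordS k else turn_value t
    else turn_value t
  else turn0.

Lemma flag_read_up j k b s e : s < e -> acts s = Some (j, FlagRS k) ->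
  acts e = Some (j, FlagRE k b) -> quiet acts j s e ->
  (forall u, s < u <= e -> up (cp u k)) -> b = true.
Proof.
move=> se Es Ee qs u_up; have [|bt _] := flag_read se Es Ee qs.
  by move=> u /u_up; case: (cp u k).
by apply: bt; apply: u_up; lia.
Qed.

Lemma flag_read_down j k b s e : s < e -> acts s = Some (j, FlagRS k) ->
  acts e = Some (j, FlagRE k b) -> quiet acts j s e ->
  (forall u, s < u <= e -> down (cp u k)) -> b = false.
Proof.
move=> se Es Ee qs u_down; have [|_ bf] := flag_read se Es Ee qs.
  by move=> u /u_down; case: (cp u k).
by apply: bf; apply: u_down; lia.
Qed.

Lemma turn_content (content : nat -> 'I_n) :
  content 0 = turn0 ->
  (forall t, (forall p (v : 'I_n) s e,
      is_write h p (v : @domB n D (TURN D)) s e -> ~ (s <= t <= e)) ->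
    content t.+1 = content t) ->
  (forall p (v : 'I_n) s e, is_write h p (v : @domB n D (TURN D)) s e ->
    (forall p' (v' : 'I_n) s' e',
       is_write h p' (v' : @domB n D (TURN D)) s' e' -> s' <> s ->
       ~ overlap (s, e) (s', e')) ->
    content e.+1 = v) ->
  forall t, (forall q x, cp t q <> W3 true x) -> content t = turn_value t.
Proof.
move=> c0 idle written; elim=> [//|t IH] nw.
have [[q [x E]]|nwt] := classic (exists q x, cp t q = W3 true x).
  have [[E' _]|[a Ea T]] := cpP cp_steps t q; first by case: (nw q x); rewrite E'.
  have Ea' : a = TurnWE by rewrite E in T; inversion T.
  subst a; rewrite /= Ea E.
  have [|s [b [st Es qs Ts cs]]] := @last_event _ _ _ cp_init cp_steps t q.
    by rewrite E.
  have Eb : b = TurnWS (ordS x) by rewrite E in Ts; inversion Ts.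
  subst b.
  have w : is_write h q (ordS x : @domB n D (TURN D)) s t.
    split=> //; first exact: (history_of_acts Es erefl).
      exact: (history_of_acts Ea erefl).
    exact: silent_of_quiet.
  apply: (written q _ s t w) => p' v' s' e' w' ss ov.
  have [pq|pq] := eqVneq p' q; first by subst p'; apply: (is_write_disjoint w w' ss ov).
  have [_ Eh Eh' _] := w; have [se' Es' Ee' _] := w'.
  have [||u us us'] := overlap_common st se' _ _ ov.
  - by move=> st'; move: Eh; rewrite st' Ee'.
  - by move=> st'; move: Eh'; rewrite -st' Es'.
  have [x' [_ wb]] := turn_write_busy w'.
  by case/eqP: pq; apply: (@cp_mutex u); rewrite ?wb ?cs ?E.
have nwt' q x : cp t q <> W3 true x by move=> E; apply: nwt; exists q, x.
have -> : turn_value t.+1 = turn_value t.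
  rewrite /=; case Ea: (acts t) => [[j a]|//]; have T := cp_trans cp_steps Ea.
  by case: a Ea T => // Ea T; inversion T; case: (nwt' j k).
rewrite -IH //; apply: idle => p v s e w st.
have [x [_ wb]] := turn_write_busy w; have [se _ _ _] := w.
have [E|ne] := eqVneq s t; first by case: (nw p x); apply: wb; lia.
by case: (nwt' p x); apply: wb; lia.
Qed.

Lemma turn_read j k s e : s < e -> acts s = Some (j, TurnRS) ->
  acts e = Some (j, TurnRE k) -> quiet acts j s e ->
  (forall u q x, s < u <= e -> cp u q <> W3 true x) -> k = turn_value s.
Proof.
move=> se Es Ee qs nw.
have [_ _ [_ [content [c0 idle written read]] _] _] := runB.
rewrite -(turn_content c0 idle written) => [|q x E].
  apply: (read j k s e) => [|p v s' e' w ov].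
    split=> //; first exact: (history_of_acts Es erefl).
      exact: (history_of_acts Ee erefl).
    exact: silent_of_quiet.
  have [se' Es' Ee' _] := w; have [x [_ wb]] := turn_write_busy w.
  have [||u us us'] := overlap_common se se' _ _ ov.
  - by move=> E; have := history_of_acts Es erefl; rewrite E /h Ee'.
  - by move=> E; have := history_of_acts Ee erefl; rewrite -E /h Es'.
  by apply: (nw u p x us); apply: wb.
have [[E' _]|[a Ea T]] := cpP cp_steps s q.
  by apply: (nw s.+1 q x); [lia|rewrite E'].
have qj : q = j by move: Ea; rewrite Es => -[->].
have aE : a = TurnRS by move: Ea; rewrite Es => -[_ ->].
by rewrite aE E in T; inversion T.
Qed.

Lemma bounded_bypass i a : 1 < n -> lock_starts cf i a ->
  exists (S : nat * nat -> Prop) (b : nat),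
  [/\ forall w, S w -> assignment tr w,
      lock_exec cf i a b,
      at_most n (fun w => S w /\ overlap w (a, b))
    & at_most (n ^ 2 - 2) (fun x => loses cf i a b x /\
                              forall w, S w -> ~ (w.1 <= x.2 <= w.2))].
Proof.
move=> n1 [phR phN].
have phCs t j : cp t j = Cs <-> ph (cf t j) = Critical.
  by have [] := link_phase (linked t j).
have phRem t j : cp t j = Rem <-> ph (cf t j) = Remainder.
  by have [] := link_phase (linked t j).
have endsE j t : lock_ends cf j t <-> enters cp j t.
  by rewrite /lock_ends /enters -!phCs.
have tvS t : turn_value t.+1 = if acts t is Some (j, TurnWE) then
    if cp t j is W3 true k then ordS k else turn_value t
  else turn_value t by [].
have Ea : cp a i = Rem by apply/phRem.
have [a0 A0 T0] : exists2 a0, acts a = Some (i, a0) &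
    trans i (cp a i) a0 (cp a.+1 i).
  by have [[E _]|//] := cpP cp_steps a i; case: phN; apply/phRem; rewrite E.
have Ea1 : cp a.+1 i = W1 by rewrite Ea in T0; inversion T0.
have [[a' e0] [fw]] := flag_write_at cp_init cp_steps cp_fair Ea1.
rewrite /= => /andP[aa ae0].
have aE : a' = a.
  have [//|ne] := eqVneq a' a.
  by case: fw => _ _ _ _ /(_ a) /=; rewrite Ea; case/(_ ltac:(lia)).
subst a'.
have e01 : cp e0.+1 i = R1 false.
  case: fw => /= ae0' _ /(cp_trans cp_steps) T _ W.
  by rewrite W in T; [inversion T|lia].
have waits t : (forall u, e0 < u < t -> ~ enters cp i u) ->
    waits_until cp i e0 t.
  move=> ne u; elim: u => [|u IH] ut; first by lia.
  have [<-|ue] := eqVneq e0 u; first by rewrite e01.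
  have := IH ltac:(lia); have := ne u ltac:(lia); rewrite /enters.
  have [[-> _]//|[b _ T]] := cpP cp_steps u i.
  by case: T => // b' []; split.
have [t0 e0t0 et0] : exists2 t0, e0 < t0 & enters cp i t0.
  apply: NNPP => no.
  apply: (@waiting_ends _ _ _ _ cp_init cp_steps cp_fair cp_mutex cp_dlf tvS
    flag_read_up flag_read_down turn_read i e0 n1) => t.
  by apply: waits => u ut eu; apply: no; exists u => //; lia.
have [b [/andP[e0b _] eb nb]] := @least_witness (enters cp i) e0.+1 t0 e0t0 et0.
have wb : waits_until cp i e0 b by apply: waits => u ub; apply: nb; lia.
exists (interrupting cp acts (turn_value) i e0), b; split.
- move=> w; suff fa k : flag_write cp acts k w -> assignment tr w.
    by case=> [[/fa]|[k [x [_ /fa]]]].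
  case=> w12 Es Ee qs _; exists k, (FLAG D k), true; split=> //.
  + exact: (history_of_acts Es erefl).
  + exact: (history_of_acts Ee erefl).
  + exact: silent_of_quiet.
- split; [lia|by split|exact/endsE|].
  move=> t tb /endsE et; have [e0t|te0] := ltnP e0 t; first by apply: (nb t) et; lia.
  have [x Ex] := enters_DL cp_steps et.
  have [E|ne] := eqVneq a t; first by rewrite -E Ea in Ex.
  by case: fw => _ _ _ _ /(_ t); rewrite Ex /= => /(_ ltac:(lia)).
- apply: at_most_weaken (at_most_interrupting cp_init cp_steps cp_mutex tvS
    flag_read_up flag_read_down turn_read i e0).
  by move=> w [].
- apply: at_most_weaken (at_most_counted cp_init cp_steps cp_mutex tvS
    flag_read_up flag_read_down turn_read i e0 n1).
  move=> x [[c [xi [cx sx ex _] ov xb]] nS].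
  have ax : a <= x.2 by move: ov; rewrite /overlap /=; lia.
  have e0x : e0 < x.2.
    by rewrite ltnNge; apply/negP => xe0; apply: (nS (a, e0)); [left|rewrite /= ax].
  apply: (entry_counted_or_interrupted cp_init cp_steps cp_fair) => //.
  + exact/endsE.
  + by apply: waits_le wb; lia.
Qed.

End Simulated.
End Execution.

Theorem theorem4p13 (n : nat) (D : protocol n) (turn0 : 'I_n) :
  1 < n -> mutual_exclusion D -> deadlock_free D ->
  intermittent_bounded_bypass (algorithmB D turn0)
    (fun n => n ^ 2 - 2) (fun n => n).
Proof.
move=> n1 mutD dlfD tr cf runB i a start.
have [df [cp [df0 linked sim_step]]] := simulated runB.
exact: (bounded_bypass mutD dlfD runB df0 linked sim_step n1 start).
Qed.
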